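(* There is an absolute constant $C>0$ such that for every integer $m\ge2$, $$\max_{1\le\ell\le m}\;\max_{x\in\mathbb{R}}\left|\psi_\ell^{(m)}(x)-G_\ell^{(m)}(x)\right|\le C\,\frac{(\ln m)^{5/2}}{m^{3/2}}.$$
   Context: The Fourier transform is $\hat f(\omega)=\int_{-\infty}^{\infty} f(x)e^{-i\omega x}\,dx$. Put $j_m:=0$ if $m$ is even and $j_m:=1$ if $m$ is odd. For integers $1\le\ell\le m$ the B-spline framelet $\psi_\ell^{(m)}\in L_2(\mathbb{R})$ is the function with Fourier transform $$\hat{\psi}_\ell^{(m)}(\omega)=i^\ell e^{-\frac{i\omega j_m}{2}}\sqrt{\binom{m}{\ell}}\;\frac{\cos^{m-\ell}(\omega/4)\,\sin^{m+\ell}(\omega/4)}{(\omega/4)^m}$$ (for $m\ge2$ it is taken as a continuous function). For $1\le\ell\le m$ let $$G_{m,\ell}(x):=C_{m,\ell}\exp\left(-\frac{12x^2}{2m-\ell}\right),\qquad C_{m,\ell}:=\sqrt{\frac{6}{\pi}}\;\frac{\sqrt{\binom{m}{\ell}}}{\sqrt{m-\ell/2}\cdot4^\ell},$$ and let $G_\ell^{(m)}(x):=\left(\frac{d^\ell}{dx^\ell}G_{m,\ell}\right)\!\left(x-\frac{j_m}{2}\right)$. *)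

(* Defs.v *)
From mathcomp Require Export all_boot all_order all_algebra.
From mathcomp Require Export all_classical all_reals all_analysis.
From mathcomp Require Export complex.
Import Order.TTheory GRing.Theory Num.Theory.
Import numFieldNormedType.Exports.

Set Implicit Arguments.
Unset Strict Implicit.
Unset Printing Implicit Defensive.

Local Open Scope classical_set_scope.
Local Open Scope ring_scope.
Local Open Scope complex_scope.

(* e^{i t} for real t *)
Definition expi (R : realType) (t : R) : R[i] := cos t +i* sin t.

(* The Fourier integral of f at w; meaningful for integrable f. *)
Definition fourier (R : realType) (f : R -> R[i]) (w : R) : R[i] :=
  (\int[lebesgue_measure]_x complex.Re (f x * expi (- (w * x)))) +i*
  (\int[lebesgue_measure]_x complex.Im (f x * expi (- (w * x)))).

Definition L2norm (R : realType) (f : R -> R[i]) : \bar R :=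
  Lnorm lebesgue_measure 2%:E (fun x : R => (Normc.normc (f x))%:E).

Definition in_L2 (R : realType) (f : R -> R[i]) : Prop :=
  [/\ measurable_fun setT (fun x : R => complex.Re (f x)),
      measurable_fun setT (fun x : R => complex.Im (f x))
    & (L2norm f < +oo)%E].

Definition restrict_sym (R : realType) (f : R -> R[i]) (n : nat) (x : R)
    : R[i] :=
  f x * (\1_(`[- n%:R, n%:R]%classic : set R) x)%:C.

(* A function f in L_2 need not be integrable, so its Fourier transform is
   the L_2-limit of the Fourier integrals of its restrictions to [-n, n]
   (Plancherel); it agrees almost everywhere with the Fourier integral of f
   when f is also integrable. *)
Definition has_fourier_L2 (R : realType) (f g : R -> R[i]) : Prop :=
  [/\ in_L2 f, in_L2 g
    & (fun n : nat => L2norm (fun w => fourier (restrict_sym f n) w - g w))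
        @ \oo --> 0%E].

Definition jpar (R : realType) (m : nat) : R := (odd m)%:R.

(* At w = 0 the quotient is 0 by the convention x / 0 = 0, which is also its
   limit there since 1 <= l. *)
Definition psi_hat (R : realType) (m l : nat) (w : R) : R[i] :=
  'i%C ^+ l * expi (- (w * jpar R m / 2)) *
  (Num.sqrt ('C(m, l)%:R) *
   (cos (w / 4) ^+ (m - l) * sin (w / 4) ^+ (m + l) / (w / 4) ^+ m))%:C.

(* Both conditions determine psi uniquely: the Fourier transform fixes it
   almost everywhere, continuity then fixes it at every point. *)
Definition bspline_framelet (R : realType) (m l : nat) (psi : R -> R[i])
    : Prop :=
  has_fourier_L2 psi (psi_hat m l) /\ continuous (psi : R -> R[i]^o).

Definition gaussC (R : realType) (m l : nat) : R :=
  Num.sqrt (6 / pi) *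
  (Num.sqrt ('C(m, l)%:R) / (Num.sqrt (m%:R - l%:R / 2) * 4 ^+ l)).

Definition gauss (R : realType) (m l : nat) (x : R) : R :=
  gaussC R m l * expR (- (12 * x ^+ 2 / (2 * m%:R - l%:R))).

Definition gauss_deriv (R : realType) (m l : nat) (x : R) : R :=
  derive1n l (@gauss R m l) (x - jpar R m / 2).

(* Main.v *)
Require Import Defs.
From mathcomp Require Import measurable_realfun ring lra zify.
Import Order.TTheory GRing.Theory Num.Theory.
Import numFieldNormedType.Exports.

(**
Put t = w/4. Up to a phase, the transforms of psi and of the Gaussian derivative are
    F(t) = sqrt C(m,l) cos^(m-l) t sin^(m+l) t / t^m  and
    G(t) = sqrt C(m,l) t^l exp(-(2m-l) t^2/3),
so by Fourier inversion the error is at most a multiple of the L1 norm of F - G.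
For |t| <= 1 both cos t and sin t / t agree with exp(-t^2/2) and exp(-t^2/6) up to a
factor in [1 - t^4/4, 1], hence |F - G| <= (m t^4/2) G by Bernoulli's inequality, while
G <= exp(-m t^2/12) because C(m,l) u^l x^l is a single term of (1 + u x)^m.  For
|t| >= 1, C(m,l) cos^(2(m-l)) sin^(2l) <= (cos^2 + sin^2)^m = 1 leaves only
|sin t / t|^m, which is exponentially small in m.  Integrating gives O(m^(-3/2)), even
without the logarithm, uniformly in l.

The transform of an L2 function is only an L2 limit; pairing it with
exp(-s w^2) e^(iwy), using Fubini on the truncations, and letting s tend to 0 recovers
the value of a continuous function at y.
*)

Set Implicit Arguments.
Unset Strict Implicit.
Unset Printing Implicit Defensive.

Local Open Scope classical_set_scope.
Local Open Scope ring_scope.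

(** * Taylor bounds *)

(** The exponent 3/2 splits as 1 + 1/2: on the scale t ~ m^(-1/2) where the Gaussian symbol lives, m
    t^4 is of order 1/m, and integrating over that width gains another m^(-1/2). So that the whole
    line can be integrated at once, the bound [symbol_diff_le] holds for every t, and its tail term
    keeps the fixed integrable weight 1/(1 + t^2/4); only the remaining powers pay for m^(-3/2). A
    Gaussian serves as pairing weight because it is square integrable, as testing an L2 limit
    requires, and because its transform is an explicit approximate identity. All integrals are real:
    the imaginary part of an identity for f is the real part of the identity for -i f, whose
    components are Im f and -Re f. A single family of Gaussian moments with a phase yields the
    inversion kernel, the Gaussian derivatives and the vanishing of the sine parts. *)

Section pointwise_derivatives.
Context {R : realType}.
Implicit Types (f g : R -> R) (x : R).

Lemma is_derive_addfun f g x (df dg : R) :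
  is_derive x 1 f df -> is_derive x 1 g dg ->
  is_derive x 1 (fun y => f y + g y) (df + dg).
Proof. exact: is_deriveD. Qed.

Lemma is_derive_oppfun f x (df : R) :
  is_derive x 1 f df -> is_derive x 1 (fun y => - f y) (- df).
Proof. exact: is_deriveN. Qed.

Lemma is_derive_mulfun f g x (df dg : R) :
  is_derive x 1 f df -> is_derive x 1 g dg ->
  is_derive x 1 (fun y => f y * g y) (f x * dg + g x * df).
Proof. exact: is_deriveM. Qed.

Lemma is_derive_expfun f n x (df : R) :
  is_derive x 1 f df ->
  is_derive x 1 (fun y => f y ^+ n) (n%:R * f x ^+ n.-1 * df).
Proof.
move=> fdf; have := @is_deriveX R _ f n x 1 df fdf.
by rewrite (_ : f ^+ n = (fun y => f y ^+ n)) //; apply/funext => y; rewrite fctE.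
Qed.

Lemma is_derive_constfun (a x : R) : is_derive x 1 (fun=> a) 0.
Proof. exact: is_derive_cst. Qed.

Lemma is_derive_idfun x : is_derive x 1 (fun y : R => y) 1.
Proof. exact: is_derive_id. Qed.

Lemma is_derive_expR_comp f x (df : R) : is_derive x 1 f df ->
  is_derive x 1 (fun y => expR (f y)) (expR (f x) * df).
Proof. by move=> fdf; apply: (is_derive1_comp (f := expR)). Qed.

Lemma is_derive_sin_comp f x (df : R) : is_derive x 1 f df ->
  is_derive x 1 (fun y => sin (f y)) (cos (f x) * df).
Proof. by move=> fdf; apply: (is_derive1_comp (f := sin)). Qed.

Lemma is_derive_cos_comp f x (df : R) : is_derive x 1 f df ->
  is_derive x 1 (fun y => cos (f y)) (- sin (f x) * df).
Proof. by move=> fdf; apply: (is_derive1_comp (f := cos)). Qed.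

End pointwise_derivatives.

Ltac is_derive_step :=
  first [ exact: is_derive_constfun | exact: is_derive_idfun
        | eapply is_derive_addfun | eapply is_derive_oppfun
        | eapply is_derive_mulfun | eapply is_derive_expfun
        | eapply is_derive_expR_comp | eapply is_derive_sin_comp
        | eapply is_derive_cos_comp ].
Ltac derive_auto := eapply is_derive_eq; [repeat is_derive_step|].

Section taylor.
Context {R : realType}.

(** The derivative of each Taylor remainder below is the preceding remainder, so this single step
    turns every bound into the next one. *)
Lemma derive_ge0_ge0 (f f' : R -> R) :
  (forall x : R, is_derive x 1 f (f' x)) -> (forall x, 0 <= x -> 0 <= f' x) ->
  0 <= f 0 -> forall x, 0 <= x -> 0 <= f x.
Proof.
move=> df f'0 f0 x x0.
have [|c c0 E] := @MVT_segment R f f' 0 x x0 (fun y _ => df y).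
  by apply: derivable_within_continuous => y _; exact: ex_derive.
 move: c0; rewrite in_itv/= => /andP[c0 _].
  have : 0 <= f x - f 0 by rewrite E subr0 mulr_ge0 ?f'0.
  by rewrite subr_ge0; exact: le_trans.
Qed.

Lemma sin_le_id (x : R) : 0 <= x -> sin x <= x.
Proof.
move=> x0; rewrite -subr_ge0; move: x x0.
have d (x : R) : is_derive x 1 (fun x : R => x - sin x) (1 - cos x).
  by derive_auto; ring.
apply: (derive_ge0_ge0 d); first by move=> x _; rewrite subr_ge0 cos_le1.
by rewrite sin0 subrr.
Qed.

Lemma cos_ge_taylor2 (x : R) : 0 <= x -> 1 - x ^+ 2 / 2 <= cos x.
Proof.
move=> x0; rewrite -subr_ge0; move: x x0.
have d (x : R) : is_derive x 1 (fun x : R => cos x - (1 - x ^+ 2 / 2)) (x - sin x).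
  by derive_auto => /=; field.
apply: (derive_ge0_ge0 d); first by move=> x x0; rewrite subr_ge0 sin_le_id.
by rewrite cos0; lra.
Qed.

Lemma sin_ge_taylor3 (x : R) : 0 <= x -> x - x ^+ 3 / 6 <= sin x.
Proof.
move=> x0; rewrite -subr_ge0; move: x x0.
have d (x : R) : is_derive x 1 (fun x : R => sin x - (x - x ^+ 3 / 6))
  (cos x - (1 - x ^+ 2 / 2)).
  by derive_auto => /=; field.
apply: (derive_ge0_ge0 d); first by move=> x x0; rewrite subr_ge0 cos_ge_taylor2.
by rewrite sin0; lra.
Qed.

Lemma cos_le_taylor4 (x : R) : 0 <= x -> cos x <= 1 - x ^+ 2 / 2 + x ^+ 4 / 24.
Proof.
move=> x0; rewrite -subr_ge0; move: x x0.
have d (x : R) : is_derive x 1 (fun x : R => 1 - x ^+ 2 / 2 + x ^+ 4 / 24 - cos x)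
  (sin x - (x - x ^+ 3 / 6)).
  by derive_auto => /=; field.
apply: (derive_ge0_ge0 d); first by move=> x x0; rewrite subr_ge0 sin_ge_taylor3.
by rewrite cos0; lra.
Qed.

Lemma sin_le_taylor5 (x : R) :
  0 <= x -> sin x <= x - x ^+ 3 / 6 + x ^+ 5 / 120.
Proof.
move=> x0; rewrite -subr_ge0; move: x x0.
have d (x : R) : is_derive x 1 (fun x : R => x - x ^+ 3 / 6 + x ^+ 5 / 120 - sin x)
  (1 - x ^+ 2 / 2 + x ^+ 4 / 24 - cos x).
  by derive_auto => /=; field.
apply: (derive_ge0_ge0 d); first by move=> x x0; rewrite subr_ge0 cos_le_taylor4.
by rewrite sin0; lra.
Qed.

Lemma expRN_le_taylor2 (x : R) : 0 <= x -> expR (- x) <= 1 - x + x ^+ 2 / 2.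
Proof.
move=> x0; rewrite -subr_ge0; move: x x0.
have d (x : R) : is_derive x 1 (fun x : R => 1 - x + x ^+ 2 / 2 - expR (- x))
  (expR (- x) - (1 - x)).
  by derive_auto => /=; field.
apply: (derive_ge0_ge0 d); first by move=> x x0; rewrite subr_ge0 expR_ge1Dx.
by rewrite oppr0 expR0; lra.
Qed.

Lemma expRN_ge_taylor3 (x : R) :
  0 <= x -> 1 - x + x ^+ 2 / 2 - x ^+ 3 / 6 <= expR (- x).
Proof.
move=> x0; rewrite -subr_ge0; move: x x0.
have d (x : R) : is_derive x 1 (fun x : R => expR (- x) - (1 - x + x ^+ 2 / 2 - x ^+ 3 / 6))
  (1 - x + x ^+ 2 / 2 - expR (- x)).
  by derive_auto => /=; field.
apply: (derive_ge0_ge0 d); first by move=> x x0; rewrite subr_ge0 expRN_le_taylor2.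
by rewrite oppr0 expR0; lra.
Qed.

Lemma expR_ge_taylor2 (x : R) : 0 <= x -> 1 + x + x ^+ 2 / 2 <= expR x.
Proof.
move=> x0; rewrite -subr_ge0; move: x x0.
have d (x : R) : is_derive x 1 (fun x : R => expR x - (1 + x + x ^+ 2 / 2))
  (expR x - (1 + x)).
  by derive_auto => /=; field.
apply: (derive_ge0_ge0 d); first by move=> x x0; rewrite subr_ge0 expR_ge1Dx.
by rewrite expR0; lra.
Qed.

End taylor.

(** * Comparison of the two symbols *)

Section pointwise.
Context {R : realType}.

Lemma cos_gauss_bounds (t : R) : 0 <= t <= 1 ->
  (1 - t ^+ 4 / 4) * expR (- (t ^+ 2 / 2)) <= cos t <= expR (- (t ^+ 2 / 2)).
Proof.
move=> /andP[t0 t1].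
have v0 : 0 <= t ^+ 2 / 2 by rewrite divr_ge0 // sqr_ge0.
have v1 : t ^+ 2 / 2 <= 1 / 2 by rewrite ler_pM2r ?invr_gt0 // expr_le1.
have := cos_ge_taylor2 t0; have := cos_le_taylor4 t0.
have := expRN_le_taylor2 v0; have := expRN_ge_taylor3 v0.
have -> : t ^+ 4 = 4 * (t ^+ 2 / 2) ^+ 2 by field.
have e0 := expR_ge0 (- (t ^+ 2 / 2)).
move: (t ^+ 2 / 2) v0 v1 e0 => v v0 v1; move: (expR _) (cos _) => e c e0 h1 h2 h3 h4.
apply/andP; split; last first.
  have : 0 <= v ^+ 2 * (2 - v) by rewrite mulr_ge0 ?sqr_ge0 //; lra.
  lra.
have : (1 - v ^+ 2) * e <= (1 - v ^+ 2) * (1 - v + v ^+ 2 / 2).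
  by rewrite ler_wpM2l //; nra.
(* (1 - v^2)(1 - v + v^2/2) = 1 - v - (v(1 - v))^2/2, and 1 - v <= cos t. *)
have : 0 <= (v * (1 - v)) ^+ 2 by exact: sqr_ge0.
lra.
Qed.

(** With v = t^2/6 the two Taylor polynomials compare as long as v <= 6/5. The range beyond t = 1 is
    there for [sin_sqr_le], which reaches t^2 = 6. *)
Lemma sin_le_gauss (t : R) : 0 <= t -> t ^+ 2 <= 7 ->
  sin t <= t * expR (- (t ^+ 2 / 6)).
Proof.
move=> t0 t7.
have v0 : 0 <= t ^+ 2 / 6 by rewrite divr_ge0 // sqr_ge0.
have v1 : t ^+ 2 / 6 <= 7 / 6 by rewrite ler_pM2r ?invr_gt0.
apply: (le_trans (sin_le_taylor5 t0)).
have -> : t - t ^+ 3 / 6 + t ^+ 5 / 120 =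
  t * (1 - t ^+ 2 / 6 + 3 / 10 * (t ^+ 2 / 6) ^+ 2) by field.
rewrite ler_wpM2l //; apply: le_trans (expRN_ge_taylor3 v0).
move: (t ^+ 2 / 6) v0 v1 => v v0 v1; nra.
Qed.

Lemma sin_ge_gauss (t : R) : 0 <= t <= 1 ->
  (1 - t ^+ 4 / 4) * (t * expR (- (t ^+ 2 / 6))) <= sin t.
Proof.
move=> /andP[t0 t1].
have v0 : 0 <= t ^+ 2 / 6 by rewrite divr_ge0 // sqr_ge0.
have v1 : t ^+ 2 / 6 <= 1 / 6 by rewrite ler_pM2r ?invr_gt0 // expr_le1.
apply: le_trans (sin_ge_taylor3 t0).
have -> : t - t ^+ 3 / 6 = t * (1 - t ^+ 2 / 6) by field.
rewrite mulrCA ler_wpM2l //.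
have := expRN_le_taylor2 v0; have e0 := expR_ge0 (- (t ^+ 2 / 6)).
have -> : t ^+ 4 = 36 * (t ^+ 2 / 6) ^+ 2 by field.
move: (t ^+ 2 / 6) v0 v1 e0 => v v0 v1; move: (expR _) => e e0 h1.
have : (1 - 9 * v ^+ 2) * e <= (1 - 9 * v ^+ 2) * (1 - v + v ^+ 2 / 2).
  by rewrite ler_wpM2l //; nra.
have v2 := sqr_ge0 v.
have : 0 <= v ^+ 2 * (17 / 2 - 9 * v + 9 / 2 * v ^+ 2) by rewrite mulr_ge0 //; lra.
lra.
Qed.

Lemma bernoulli_le (x : R) n : 0 <= x <= 1 -> 1 - n%:R * x <= (1 - x) ^+ n.
Proof.
move=> /andP[x0 x1]; elim: n => [|n IH]; first by rewrite expr0 mul0r subr0.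
rewrite exprS -natr1; have n0 : 0 <= n%:R :> R by [].
have : (1 - x) * (1 - n%:R * x) <= (1 - x) * (1 - x) ^+ n.
  by rewrite ler_wpM2l // subr_ge0.
nra.
Qed.

Lemma binom_term_le (a b : R) m l : (l <= m)%N -> 0 <= a -> 0 <= b ->
  'C(m, l)%:R * (a ^+ (m - l) * b ^+ l) <= (a + b) ^+ m.
Proof.
move=> lm a0 b0; rewrite exprDn.
have lm1 : (l < m.+1)%N by rewrite ltnS.
rewrite (bigD1 (Ordinal lm1)) //= [leLHS]mulr_natl lerDl.
by apply: sumr_ge0 => i _; rewrite mulrn_wge0 // mulr_ge0 // exprn_ge0.
Qed.

(** The inequality behind [binom_gauss_le] for one of the m factors; the leftover exp(-u/6) is a
    decay rate that does not depend on [l]. It amounts to 1 <= exp(2u/3)(exp(u/2) - u), where second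
    and first order Taylor bounds suffice. *)
Lemma gauss_base_le (u : R) : 0 <= u ->
  1 + u * expR (2 / 3 * u) <= expR (4 / 3 * u) * expR (- (u / 6)).
Proof.
move=> u0; rewrite -expRD.
have -> : 4 / 3 * u + - (u / 6) = 2 / 3 * u + u / 2 by field.
rewrite expRD.
have := @expR_ge_taylor2 R (u / 2); have := expR_ge1Dx (2 / 3 * u).
move: (expR (u / 2)) (expR (2 / 3 * u)) => f e h1 h2.
have {}h2 : 1 + u / 2 + (u / 2) ^+ 2 / 2 <= f by apply: h2; lra.
have e1 : 1 <= e * (1 - u / 2 + u ^+ 2 / 8).
  have u2 : 0 <= 1 - u / 2 + u ^+ 2 / 8 by have := sqr_ge0 (u - 2); lra.
  apply: le_trans (ler_wpM2r u2 h1).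
  have : 0 <= u * (1 / 6 - 5 / 24 * u + u ^+ 2 / 12).
    by rewrite mulr_ge0 //; have := sqr_ge0 (u - 5 / 4); lra.
  lra.
have : e * (1 + u / 2 + (u / 2) ^+ 2 / 2) <= e * f by rewrite ler_wpM2l //; lra.
lra.
Qed.

(* The left-hand side is exp(-4/3 u m) times one binomial term of
   (1 + u exp(2/3 u))^m. *)
Lemma binom_gauss_le (m l : nat) (u : R) : (l <= m)%N -> 0 <= u ->
  'C(m, l)%:R * u ^+ l * expR (- ((2 * m%:R - l%:R) * u / 3)) ^+ 2 <=
  expR (- (u * m%:R / 6)).
Proof.
move=> lm u0.
have -> : expR (- ((2 * m%:R - l%:R) * u / 3)) ^+ 2 =
   expR (2 / 3 * u) ^+ l * expR (- (4 / 3 * u)) ^+ m.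
  by rewrite -!expRM_natl -expRD; congr expR; field.
have := @binom_term_le 1 (u * expR (2 / 3 * u)) m l lm ler01.
rewrite expr1n mul1r exprMn => /(_ (mulr_ge0 u0 (expR_ge0 _))) h.
rewrite mulrA -(mulrA _ (u ^+ l)); apply: (le_trans (ler_wpM2r _ h)).
  by rewrite exprn_ge0 // expR_ge0.
rewrite -exprMn (_ : - (u * m%:R / 6) = m%:R * - (u / 6)); last by field.
rewrite expRM_natl; apply: lerXn2r; rewrite ?nnegrE ?expR_ge0 //.
  by rewrite mulr_ge0 ?expR_ge0 // addr_ge0 // mulr_ge0 ?expR_ge0.
rewrite (expRN (4 / 3 * u)) ler_pdivrMr ?expR_gt0 // [leRHS]mulrC; exact: gauss_base_le.
Qed.

Lemma sqrt_binom_gauss_le (m l : nat) (t : R) : (l <= m)%N -> 0 <= t ->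
  Num.sqrt 'C(m, l)%:R * (t ^+ l * expR (- ((2 * m%:R - l%:R) * t ^+ 2 / 3))) <=
  expR (- (m%:R * t ^+ 2 / 12)).
Proof.
move=> lm t0; rewrite -(@ler_pXn2r _ 2) ?nnegrE ?expR_ge0 //; last first.
  by rewrite mulr_ge0 ?sqrtr_ge0 // mulr_ge0 ?expR_ge0 // exprn_ge0.
rewrite !exprMn sqr_sqrtr // -exprM (mulnC l) exprM mulrA.
apply: (le_trans (binom_gauss_le lm (sqr_ge0 t))).
by rewrite -expRM_natl ler_expR le_eqVlt; apply/orP; left; apply/eqP; field.
Qed.

(** For small t, sin^2 t <= t^2 exp(-t^2/3) and exp(t^2/3) >= 1 + t^2/3; for large t, sin^2 t <= 1
    is enough. Powers of this rational majorant of (sin t/t)^2 are integrable and, at t >= 1,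
    geometrically small. *)
Lemma sin_sqr_le (t : R) : sin t ^+ 2 * (1 + t ^+ 2 / 4) <= t ^+ 2.
Proof.
wlog t0 : t / 0 <= t.
  move=> H; have [|t0] := lerP 0 t; first exact: H.
  by rewrite -(sqrrN t) -sqrrN -sinN; apply: H; lra.
(* Up to 6 the bound t - t^3/6 shows sin t >= 0, which is needed to square [sin_le_gauss]. *)
have [t6|t6] := lerP (t ^+ 2) 6; last first.
  have := cos2Dsin2 t; have := sqr_ge0 (cos t).
  by move: (cos t ^+ 2) (sin t ^+ 2) (t ^+ 2) t6 => c s u *; nra.
have t7 : t ^+ 2 <= 7 by lra.
have s0 : 0 <= sin t.
  apply: le_trans (sin_ge_taylor3 t0).
  have -> : t - t ^+ 3 / 6 = t * (1 - t ^+ 2 / 6) by field.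
  by rewrite mulr_ge0 //; lra.
have h : sin t ^+ 2 <= t ^+ 2 * expR (- (t ^+ 2 / 3)).
  have -> : expR (- (t ^+ 2 / 3)) = expR (- (t ^+ 2 / 6)) ^+ 2.
    by rewrite -expRM_natl; congr expR; field.
  rewrite -exprMn lerXn2r ?nnegrE ?mulr_ge0 ?expR_ge0 //; exact: sin_le_gauss.
have e1 : expR (- (t ^+ 2 / 3)) * (1 + t ^+ 2 / 4) <= 1.
  rewrite expRN mulrC ler_pdivrMr ?expR_gt0 // mul1r.
  apply: le_trans (expR_ge1Dx _); have := sqr_ge0 t; lra.
have u0 := sqr_ge0 t.
apply: (@le_trans _ _ (t ^+ 2 * expR (- (t ^+ 2 / 3)) * (1 + t ^+ 2 / 4))).
  by rewrite ler_wpM2r //; lra.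
by rewrite -mulrA ler_piMr.
Qed.

(* At t = 0 this is 0 by the convention x / 0 = 0, like [gauss_symbol] when 0 < l. *)
Definition framelet_symbol (m l : nat) (t : R) : R :=
  Num.sqrt 'C(m, l)%:R * (cos t ^+ (m - l) * sin t ^+ (m + l) / t ^+ m).

Definition gauss_symbol (m l : nat) (t : R) : R :=
  Num.sqrt 'C(m, l)%:R * (t ^+ l * expR (- ((2 * m%:R - l%:R) * t ^+ 2 / 3))).

Lemma framelet_symbolN m l t : (l <= m)%N ->
  framelet_symbol m l (- t) = (-1) ^+ l * framelet_symbol m l t.
Proof.
move=> lm; rewrite /framelet_symbol cosN sinN (exprNn (sin t)) (exprNn t).
rewrite invfM (exprD (-1)) invr_sign.
have a2 : (-1) ^+ m * (-1) ^+ m = 1 :> R by rewrite -expr2 sqrr_sign.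
rewrite -[RHS]mul1r -[X in _ = X * _]a2; ring.
Qed.

Lemma gauss_symbolN m l t :
  gauss_symbol m l (- t) = (-1) ^+ l * gauss_symbol m l t.
Proof. by rewrite /gauss_symbol sqrrN (exprNn t); ring. Qed.

Lemma framelet_symbol0 m l : (0 < l <= m)%N -> framelet_symbol m l 0 = 0.
Proof.
move=> /andP[l0 lm]; rewrite /framelet_symbol sin0 expr0n addn_eq0.
by rewrite (gtn_eqF l0) andbF mulr0 mul0r mulr0.
Qed.

Lemma gauss_symbol0 m l : (0 < l)%N -> gauss_symbol m l 0 = 0.
Proof.
by move=> l0; rewrite /gauss_symbol expr0n (gtn_eqF l0) mul0r mulr0.
Qed.

Lemma framelet_symbolE m l t : (l <= m)%N -> t != 0 -> framelet_symbol m l t =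
  Num.sqrt 'C(m, l)%:R * (t ^+ l * (cos t ^+ (m - l) * (sin t / t) ^+ (m + l))).
Proof.
move=> lm t0; rewrite /framelet_symbol expr_div_n (exprD t).
have [a0 b0] : t ^+ m != 0 /\ t ^+ l != 0 by rewrite !expf_neq0.
by field; rewrite a0 b0.
Qed.

Lemma symbol_diff_window m l t : (0 < l <= m)%N -> 0 <= t <= 1 ->
  `|framelet_symbol m l t - gauss_symbol m l t| <=
  m%:R * t ^+ 4 / 2 * gauss_symbol m l t.
Proof.
move=> /andP[l0 lm] /andP[]; rewrite le_eqVlt => /predU1P[<- _|t0 t1].
  by rewrite framelet_symbol0 ?l0 // gauss_symbol0 // subrr normr0 mulr0.
have t01 : 0 <= t <= 1 by rewrite t1 ltW.
have [/andP[c1 c2] s1] := (cos_gauss_bounds t01, sin_ge_gauss t01).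
have s2 : sin t <= t * expR (- (t ^+ 2 / 6)).
  by apply: sin_le_gauss; [exact: ltW|nra].
rewrite framelet_symbolE ?gt_eqF // /gauss_symbol.
have -> : expR (- ((2 * m%:R - l%:R) * t ^+ 2 / 3)) =
    expR (- (t ^+ 2 / 2)) ^+ (m - l) * expR (- (t ^+ 2 / 6)) ^+ (m + l).
  by rewrite -!expRM_natl -expRD natrB // natrD; congr expR; field.
have q01 : 0 <= t ^+ 4 / 4 <= 1.
  have : 0 <= t ^+ 4 <= 1 by rewrite exprn_ge0 ?exprn_ile1 // ltW.
  lra.
set q := 1 - _ in c1 s1.
have q0 : 0 <= q by rewrite /q; lra.
have {}s2 : sin t / t <= expR (- (t ^+ 2 / 6)) by rewrite ler_pdivrMr // mulrC.
have {}s1 : q * expR (- (t ^+ 2 / 6)) <= sin t / t.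
  by rewrite ler_pdivlMr // -mulrA [expR _ * t]mulrC.
(* The two exponents add up to 2m whatever [l] is, so the loss t^4/4 per factor becomes m t^4/2. *)
have := bernoulli_le (m - l + (m + l)) q01.
rewrite -/q.
move: (cos t) (sin t / t) c1 c2 s1 s2 => c s c1 c2 s1 s2 hq.
have e1 := expR_ge0 (- (t ^+ 2 / 2)); have e2 := expR_ge0 (- (t ^+ 2 / 6)).
move: (expR _) c1 c2 e1 => E1 c1 c2 e1; move: (expR _) s1 s2 e2 => E2 s1 s2 e2.
have c0 : 0 <= c by apply: le_trans c1; rewrite mulr_ge0.
have s0 : 0 <= s by apply: le_trans s1; rewrite mulr_ge0.
have up : c ^+ (m - l) * s ^+ (m + l) <= E1 ^+ (m - l) * E2 ^+ (m + l).
  by apply: ler_pM; rewrite ?exprn_ge0 //; apply: lerXn2r; rewrite ?nnegrE.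
have low : q ^+ (m - l + (m + l)) * (E1 ^+ (m - l) * E2 ^+ (m + l)) <=
    c ^+ (m - l) * s ^+ (m + l).
  rewrite exprD mulrACA -!exprMn.
  by apply: ler_pM; rewrite ?exprn_ge0 ?mulr_ge0 //; apply: lerXn2r;
    rewrite ?nnegrE ?mulr_ge0.
have E0 : 0 <= E1 ^+ (m - l) * E2 ^+ (m + l) by rewrite mulr_ge0 ?exprn_ge0.
rewrite distrC -!mulrBr ger0_norm; last first.
  by rewrite mulr_ge0 ?sqrtr_ge0 // mulr_ge0 ?exprn_ge0 ?subr_ge0 // ltW.
rewrite [leRHS]mulrCA ler_wpM2l ?sqrtr_ge0 // [leRHS]mulrCA.
rewrite ler_wpM2l ?exprn_ge0 //; first exact: ltW.
rewrite lerBlDr -lerBlDl; apply: le_trans low.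
rewrite -[X in X - _]mul1r -mulrBl ler_wpM2r //; apply: le_trans hq.
by rewrite natrD natrB // natrD; lra.
Qed.

End pointwise.

(** * Decay of the framelet symbol and the error bound on the whole line *)

Section tails.
Context {R : realType}.

(* C(m,l) cos^(2(m-l)) sin^(2l) is one term of (cos^2 + sin^2)^m = 1. *)
Lemma sqr_framelet_symbol_le m l (t : R) : (0 < l <= m)%N ->
  framelet_symbol m l t ^+ 2 * (1 + t ^+ 2 / 4) ^+ m <= 1.
Proof.
move=> lm0; have /andP[l0 lm] := lm0.
have [->|t0] := eqVneq t 0.
  by rewrite framelet_symbol0 // expr0n mul0r.
have t2 : 0 < t ^+ 2 by rewrite exprn_even_gt0.
have -> : framelet_symbol m l t ^+ 2 = 'C(m, l)%:R *
    ((cos t ^+ 2) ^+ (m - l) * (sin t ^+ 2) ^+ l) * (sin t ^+ 2 / t ^+ 2) ^+ m.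
  rewrite /framelet_symbol (exprD (sin t)) !exprMn !exprVn sqr_sqrtr ?ler0n //.
  by rewrite !(exprAC _ _ 2) !expr2 !exprMn; ring.
rewrite -mulrA -exprMn mulr_ile1 //.
- by rewrite mulr_ge0 // mulr_ge0 // exprn_ge0 // sqr_ge0.
- by rewrite exprn_ge0 // mulr_ge0 ?divr_ge0 ?sqr_ge0 //; lra.
- have := binom_term_le lm (sqr_ge0 (cos t)) (sqr_ge0 (sin t)).
  by rewrite cos2Dsin2 expr1n.
- apply: exprn_ile1; first by rewrite mulr_ge0 ?divr_ge0 ?sqr_ge0 //; lra.
  by rewrite mulrAC ler_pdivrMr // mul1r sin_sqr_le.
Qed.

(** Since m >= 2, a full factor 1 + t^2/4 survives the square root: an integrable majorant common to
    all [m] and [l]. *)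
Lemma framelet_symbol_le m l (t : R) : (2 <= m)%N -> (0 < l <= m)%N ->
  `|framelet_symbol m l t| <= (1 + t ^+ 2 / 4)^-1.
Proof.
move=> m2 lm; have u0 : 0 < 1 + t ^+ 2 / 4 by have := sqr_ge0 t; lra.
rewrite -[leRHS]mul1r ler_pdivlMr // -(@ler_pXn2r _ 2) ?nnegrE //; last first.
  by rewrite mulr_ge0 // ltW.
rewrite exprMn real_normK ?num_real // expr1n.
apply: le_trans (sqr_framelet_symbol_le t lm).
by rewrite ler_wpM2l ?sqr_ge0 // ler_weXn2l //; have := sqr_ge0 t; lra.
Qed.

(** 5/4 is the value of 1 + t^2/4 at t = 1, and m^3 is the square of the target rate m sqrt m. The
    bound is x^3/3! <= exp x at x = m ln(5/4). *)
Lemma cube_geometric_bounded :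
  exists2 K : R, 0 < K & forall m : nat, m%:R ^+ 3 <= K * (5 / 4) ^+ m.
Proof.
have k0 : 0 < ln (5 / 4 : R) by apply: ln_gt0; lra.
exists (6 / ln (5 / 4 : R) ^+ 3) => [|m]; first by rewrite divr_gt0 // exprn_gt0.
have mk0 : 0 <= m%:R * ln (5 / 4 : R) by rewrite mulr_ge0 // ltW.
have := expR_ge1Dxn 2 mk0; rewrite expRM_natl lnK ?posrE; last by lra.
move=> h.
rewrite mulrAC ler_pdivlMr ?exprn_gt0 // -exprMn.
by move: h; rewrite (_ : 3`!%:R = 6 :> R) //; lra.
Qed.

Lemma framelet_symbol_tail : exists2 K : R, 0 < K &
  forall m l (t : R), (2 <= m)%N -> (0 < l <= m)%N -> 1 <= t ->
  `|framelet_symbol m l t| <= K / (m%:R * Num.sqrt m%:R) / (1 + t ^+ 2 / 4).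
Proof.
have [K K0 hK] := cube_geometric_bounded.
(* Two of the m powers of 1 + t^2/4 are kept for integrability; 25/16 = (5/4)^2 compensates for them
   in [cube_geometric_bounded]. The square root appears because everything is squared. *)
exists (Num.sqrt (25 / 16 * K)) => [|m l t m2 lm t1]; first by rewrite sqrtr_gt0; lra.
have t2 : 1 <= t ^+ 2 by rewrite exprn_ege1.
have m0 : 0 < m%:R :> R by rewrite ltr0n; lia.
have M0 : 0 < m%:R * Num.sqrt m%:R :> R by rewrite mulr_gt0 ?sqrtr_gt0.
have u0 : 0 < 1 + t ^+ 2 / 4 by lra.
rewrite ler_pdivlMr // ler_pdivlMr // -(@ler_pXn2r _ 2) ?nnegrE ?sqrtr_ge0 //; last first.
  by rewrite !mulr_ge0 // ?sqrtr_ge0 // ltW.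
rewrite !exprMn real_normK ?num_real // !sqr_sqrtr ?(ltW m0) //; last by lra.
have hF := sqr_framelet_symbol_le t lm; have hM := hK m.
have mE : (m = 2 + (m - 2))%N by lia.
rewrite {2}mE exprD in hM; rewrite {2}mE exprD in hF; move: hM hF.
have : (5 / 4) ^+ (m - 2) <= (1 + t ^+ 2 / 4) ^+ (m - 2).
  by apply: lerXn2r; rewrite ?nnegrE; lra.
move: (framelet_symbol m l t) => F.
set p := (5 / 4) ^+ (m - 2); set w := _ ^+ (m - 2); set u := 1 + _ => pw hM hF.
have Fu0 : 0 <= F ^+ 2 * u ^+ 2 by rewrite mulr_ge0 // sqr_ge0.
have h1 : F ^+ 2 * u ^+ 2 * m%:R ^+ 3 <=
    F ^+ 2 * u ^+ 2 * (K * ((5 / 4) ^+ 2 * w)).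
  rewrite ler_wpM2l //; apply: le_trans hM _.
  by rewrite !ler_wpM2l // ?exprn_ge0 // ?ltW //; lra.
have h2 : K * (F ^+ 2 * (u ^+ 2 * w)) <= K * 1 by rewrite ler_wpM2l // ltW.
lra.
Qed.

Lemma symbol_diff_le : exists2 K : R, 0 < K &
  forall m l (t : R), (2 <= m)%N -> (0 < l <= m)%N ->
  `|framelet_symbol m l t - gauss_symbol m l t| <=
  K / m%:R * expR (- (m%:R * t ^+ 2 / 24)) +
  K / (m%:R * Num.sqrt m%:R) / (1 + t ^+ 2 / 4).
Proof.
have [K0 K00 hK] := framelet_symbol_tail.
(* 1152 = 2 * 24^2, from m t^4 = (24^2/m) z^2 with z = m t^2/24 and z^2/2 <= exp z: half of the
   exponent m t^2/12 absorbs the polynomial factor. *)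
have [c c0 cE] : exists2 c : R, 0 < c & c = 1152 by exists 1152; [lra|].
exists (K0 + c) => [|m l t m2 lm]; first by lra.
wlog t0 : t / 0 <= t.
  move=> H; have [|t0] := lerP 0 t; first exact: H.
  have := H (- t); have /andP[_ lm'] := lm.
  rewrite framelet_symbolN // gauss_symbolN sqrrN -mulrBr normrM normr_sign mul1r.
  by apply; lra.
have m0 : 0 < m%:R :> R by rewrite ltr0n; lia.
have M0 : 0 < m%:R * Num.sqrt m%:R :> R by rewrite mulr_gt0 ?sqrtr_gt0.
have u0 : 0 < 1 + t ^+ 2 / 4 by have := sqr_ge0 t; lra.
have G0 : 0 <= gauss_symbol m l t.
  by rewrite /gauss_symbol mulr_ge0 ?sqrtr_ge0 // mulr_ge0 ?expR_ge0 ?exprn_ge0.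
have m1 : 1 <= m%:R :> R by rewrite ler1n ltnW.
have [_ lm'] := andP lm.
have G1 := sqrt_binom_gauss_le lm' t0.
have z0 : 0 <= m%:R * t ^+ 2 / 24.
  by rewrite divr_ge0 // mulr_ge0 ?sqr_ge0 // ltW.
have gauss4 : m%:R * t ^+ 4 * gauss_symbol m l t <=
    c / m%:R * expR (- (m%:R * t ^+ 2 / 24)).
  apply: le_trans (_ : m%:R * t ^+ 4 * expR (- (m%:R * t ^+ 2 / 12)) <= _).
    by rewrite ler_wpM2l // mulr_ge0 ?exprn_ge0 // ltW.
  have -> : - (m%:R * t ^+ 2 / 12) = - (m%:R * t ^+ 2 / 24) - (m%:R * t ^+ 2 / 24).
    by field.
  rewrite expRD mulrA; set z := m%:R * t ^+ 2 / 24.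
  have -> : m%:R * t ^+ 4 = c / m%:R * (z ^+ 2 / 2).
    by rewrite /z cE; field; rewrite gt_eqF.
  rewrite ler_wpM2r ?expR_ge0 // -(mulrA (c / m%:R)) ler_piMr //;
    first by rewrite divr_ge0 // ltW.
  rewrite expRN ler_pdivrMr ?expR_gt0 // mul1r.
  have := z0; have := expR_ge_taylor2 z0; rewrite -/z; lra.
have tail0 : 0 <= K0 / (m%:R * Num.sqrt m%:R) / (1 + t ^+ 2 / 4).
  by rewrite !divr_ge0 // ltW.
have tail1 : 0 <= c / (m%:R * Num.sqrt m%:R) / (1 + t ^+ 2 / 4).
  by rewrite !divr_ge0 // ltW.
have g0 : 0 <= K0 / m%:R * expR (- (m%:R * t ^+ 2 / 24)).
  by rewrite mulr_ge0 ?expR_ge0 // divr_ge0 // ltW.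
have t4 : 0 <= m%:R * t ^+ 4 * gauss_symbol m l t.
  by rewrite !mulr_ge0 ?exprn_ge0 // ltW.
have window := @symbol_diff_window _ m l t lm; have tail := hK m l t m2 lm.
have normB := ler_normB (framelet_symbol m l t) (gauss_symbol m l t).
(* Outside the window m t^4 >= 1, so [gauss4] controls the Gaussian symbol there as well. *)
have t41 : 1 <= t -> gauss_symbol m l t <= m%:R * t ^+ 4 * gauss_symbol m l t.
  move=> t1; apply: ler_peMl => //; apply: mulr_ege1; [exact: m1|exact: exprn_ege1].
rewrite (ger0_norm G0) in normB.
rewrite !mulrDl; rewrite mulrAC in window.
move: (expR _) gauss4 g0 => E gauss4 g0.
move: (K0 / _ / _) tail0 tail => A tail0 tail.
move: (c / (_ * _) / _) tail1 => B tail1.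
move: (K0 / _ * E) (c / _ * E) g0 gauss4 => A' B' g0 gauss4.
move: (m%:R * _ * _) window t4 t41 gauss4 => X window t4 t41 gauss4.
have [t1|/ltW t1] := lerP t 1.
  by have := window; rewrite t0 t1 => /(_ isT); lra.
have := tail t1; have := t41 t1; lra.
Qed.

End tails.

(** * Real-valued Lebesgue integrals *)

Section pointwise_measurability.
Context d (T : measurableType d) {R : realType}.
Implicit Types f g : T -> R.

Lemma measurable_addfun f g : measurable_fun setT f -> measurable_fun setT g ->
  measurable_fun setT (fun x => f x + g x).
Proof. exact: measurable_funD. Qed.

Lemma measurable_oppfun f : measurable_fun setT f ->
  measurable_fun setT (fun x => - f x).
Proof. by move=> mf; apply: measurableT_comp. Qed.

Lemma measurable_mulfun f g : measurable_fun setT f -> measurable_fun setT g ->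
  measurable_fun setT (fun x => f x * g x).
Proof. exact: measurable_funM. Qed.

Lemma measurable_constfun (c : R) : measurable_fun setT (fun _ : T => c).
Proof. exact: measurable_cst. Qed.

Lemma measurable_normfun f : measurable_fun setT f ->
  measurable_fun setT (fun x => `|f x|).
Proof. by move=> mf; apply: measurableT_comp. Qed.

Lemma measurable_expRfun f : measurable_fun setT f ->
  measurable_fun setT (fun x => expR (f x)).
Proof. by move=> mf; apply: measurableT_comp. Qed.

Lemma measurable_cosfun f : measurable_fun setT f ->
  measurable_fun setT (fun x => cos (f x)).
Proof.
move=> mf; apply: measurableT_comp mf; apply: continuous_measurable_fun.
exact: continuous_cos.
Qed.

Lemma measurable_sinfun f : measurable_fun setT f ->
  measurable_fun setT (fun x => sin (f x)).
Proof.
move=> mf; apply: measurableT_comp mf; apply: continuous_measurable_fun.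
exact: continuous_sin.
Qed.

Lemma measurable_expfun f n : measurable_fun setT f ->
  measurable_fun setT (fun x => f x ^+ n).
Proof. exact: measurable_funX. Qed.

End pointwise_measurability.

Lemma measurable_idfun (R : realType) : measurable_fun setT (fun x : R => x).
Proof. exact: measurable_id. Qed.

Lemma measurable_fstfun d d' (T : measurableType d) (T' : measurableType d') :
  measurable_fun setT (fun z : T * T' => z.1).
Proof. exact: measurable_fst. Qed.

Lemma measurable_sndfun d d' (T : measurableType d) (T' : measurableType d') :
  measurable_fun setT (fun z : T * T' => z.2).
Proof. exact: measurable_snd. Qed.

Ltac measurable_step :=
  first [ assumption | exact: measurable_constfun | exact: measurable_idfun
        | exact: measurable_fstfun | exact: measurable_sndfun
        | apply: measurable_addfun | apply: measurable_oppfun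
        | apply: measurable_mulfun | apply: measurable_normfun
        | apply: measurable_expRfun | apply: measurable_cosfun
        | apply: measurable_sinfun | apply: measurable_expfun ].
Ltac measurable_auto := repeat measurable_step.

Section real_integrals.
Context d (T : measurableType d) {R : realType} (mu : {measure set T -> \bar R}).
Local Notation L1 f := (mu.-integrable setT (EFin \o f)).
Local Notation RI f := (Rintegral mu setT f).
Implicit Types f g : T -> R.

Lemma integrable_measurable f : L1 f -> measurable_fun setT f.
Proof. by move=> /measurable_int/measurable_EFinP. Qed.

Lemma integrable_dominated f g : measurable_fun setT f ->
  (forall x, `|f x| <= g x) -> L1 g -> L1 f.
Proof.
move=> mf fg; apply: le_integrable => //; first exact/measurable_EFinP.
by move=> x _ /=; rewrite lee_fin; apply: le_trans (fg x) _; exact: ler_norm.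
Qed.

Lemma integrable_add f g : L1 f -> L1 g -> L1 (fun x => f x + g x).
Proof. by move=> intf intg; have := integrableD measurableT intf intg. Qed.

Lemma integrable_sub f g : L1 f -> L1 g -> L1 (fun x => f x - g x).
Proof. by move=> intf intg; have := integrableB measurableT intf intg. Qed.

Lemma integrable_opp f : L1 f -> L1 (fun x => - f x).
Proof. by move=> intf; have := integrableN intf. Qed.

Lemma integrable_scale (k : R) f : L1 f -> L1 (fun x => k * f x).
Proof. by move=> intf; have := integrableZl measurableT k intf. Qed.

Lemma integrable_normfun f : L1 f -> L1 (fun x => `|f x|).
Proof. exact: integrable_norm. Qed.

Lemma integrable_mul_le1 f g : L1 f -> measurable_fun setT g ->
  (forall x, `|g x| <= 1) -> L1 (fun x => f x * g x).
Proof.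
move=> intf mg g1; have mf := integrable_measurable intf.
apply: (integrable_dominated _ _ (integrable_normfun intf)); first measurable_auto.
by move=> x; rewrite normrM ler_piMr.
Qed.

Lemma Rintegral_le f g : L1 f -> L1 g -> (forall x, f x <= g x) ->
  RI f <= RI g.
Proof. by move=> intf intg fg; apply: le_Rintegral. Qed.

Lemma Rintegral_norm_le f g : measurable_fun setT f -> (forall x, `|f x| <= g x) ->
  L1 g -> `|RI f| <= RI g.
Proof.
move=> mf fg intg; have intf := integrable_dominated mf fg intg.
apply: le_trans (le_normr_Rintegral measurableT intf) _.
by apply: Rintegral_le => //; exact: integrable_normfun.
Qed.

Lemma Rintegral_dominated (f_ : nat -> T -> R) f g :
  (forall n, measurable_fun setT (f_ n)) -> measurable_fun setT f ->
  (forall x, f_ ^~ x @ \oo --> f x) -> L1 g ->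
  (forall n x, `|f_ n x| <= g x) -> (fun n => RI (f_ n)) @ \oo --> RI f.
Proof.
move=> mf_ mf f_f intg f_g.
have cvgE x : (f_ n x)%:E @[n --> \oo] --> (f x)%:E.
  by apply: cvg_EFin; [exact: nearW|exact: f_f].
have [intf _ h] := @dominated_convergence _ _ _ mu setT measurableT
  (fun n => EFin \o f_ n) (EFin \o f) (EFin \o g)
  (fun n => proj2 (measurable_EFinP setT (f_ n)) (mf_ n))
  (proj2 (measurable_EFinP setT f) mf)
  (aeW _ (fun x _ => cvgE x)) intg (aeW _ (fun x n _ => f_g n x)).
by apply: fine_cvg; rewrite fineK //; exact: integrable_fin_num.
Qed.

End real_integrals.

(** * Gaussian majorants, truncation and boundary terms on the line *)

Section line_integrals.
Context {R : realType}.
Notation mu := (@lebesgue_measure R).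
Local Notation L1 f := (mu.-integrable setT (EFin \o f)).
Local Notation RI f := (Rintegral mu setT f).
Implicit Types f g : R -> R.

Lemma is_derive_continuous f f' :
  (forall x : R, is_derive x 1 f (f' x)) -> continuous f.
Proof.
move=> df x; apply/differentiable_continuous; rewrite -derivable1_diffP.
exact: ex_derive.
Qed.

(** Variance 1/(2a) makes the Gaussian a multiple of a normal density, from which integrability and
    total mass are inherited. *)
Lemma gauss_normal_pdf (a y : R) : 0 < a ->
  (fun x => expR (- (a * (x - y) ^+ 2))) =
  (fun x => Num.sqrt (pi / a) * normal_pdf y (Num.sqrt (2 * a)^-1) x).
Proof.
move=> a0; have s0 : Num.sqrt (2 * a)^-1 != 0.
  by rewrite gt_eqF // sqrtr_gt0 invr_gt0; lra.
have s2 : Num.sqrt (2 * a)^-1 ^+ 2 = (2 * a)^-1.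
  by rewrite sqr_sqrtr // invr_ge0; lra.
apply/funext => x; rewrite normal_pdfE // /normal_peak /normal_fun s2.
have -> : (2 * a)^-1 * pi *+ 2 = pi / a by field; lra.
rewrite mulVKf; last first.
  by rewrite gt_eqF // sqrtr_gt0 divr_gt0 // pi_gt0.
by congr expR; field; lra.
Qed.

Lemma gauss_integrable (a y : R) : 0 < a ->
  L1 (fun x => expR (- (a * (x - y) ^+ 2))).
Proof.
move=> a0; rewrite gauss_normal_pdf //; apply: integrable_scale.
exact: integrable_normal_pdf.
Qed.

Lemma Rintegral_gauss (a y : R) : 0 < a ->
  RI (fun x => expR (- (a * (x - y) ^+ 2))) = Num.sqrt (pi / a).
Proof.
move=> a0; rewrite gauss_normal_pdf // RintegralZl //; last first.
  exact: integrable_normal_pdf.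
by rewrite /Rintegral integral_normal_pdf mulr1.
Qed.

Lemma expn_le_expR (n : nat) (x : R) : 0 <= x -> x ^+ n <= n`!%:R * expR x.
Proof.
move=> x0; case: n => [|n].
  by rewrite expr0 fact0 mul1r -expR0 ler_expR.
have := expR_ge1Dxn n x0; rewrite -ler_pdivrMl ?ltr0n ?fact_gt0 // mulrC; lra.
Qed.

(** |x|^n <= 1 + x^(2n) trades the power for one of z = a x^2/2, and z^n <= n! exp z absorbs it into
    half of the exponent; this gives [K]. *)
Lemma expn_gauss_integrable (a : R) n : 0 < a ->
  L1 (fun x => `|x| ^+ n * expR (- (a * x ^+ 2))).
Proof.
move=> a0; pose K := 1 + (2 / a) ^+ n * n`!%:R.
have ga : L1 (fun x => K * expR (- (a / 2 * (x - 0) ^+ 2))).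
  by apply: integrable_scale; apply: gauss_integrable; lra.
apply: (integrable_dominated _ _ ga); first measurable_auto.
move=> x; rewrite subr0 ger0_norm; last first.
  by rewrite mulr_ge0 ?expR_ge0 // exprn_ge0.
have -> : - (a * x ^+ 2) = - (a / 2 * x ^+ 2) - (a / 2 * x ^+ 2) by field.
rewrite expRD mulrA ler_wpM2r ?expR_ge0 // expRN ler_pdivrMr ?expR_gt0 //.
have z0 : 0 <= a / 2 * x ^+ 2 by apply: mulr_ge0; [lra|exact: sqr_ge0].
have e1 : 1 <= expR (a / 2 * x ^+ 2) by apply: le_trans (expR_ge1Dx _); lra.
apply: (@le_trans _ _ (1 + (x ^+ 2) ^+ n)).
  rewrite -(@real_normK _ x) ?num_real // exprAC.
  have := sqr_ge0 (`|x| ^+ n - 1); have := sqr_ge0 (`|x| ^+ n); lra.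
rewrite /K mulrDl mul1r lerD // -(mulrA ((2 / a) ^+ n)).
have -> : (x ^+ 2) ^+ n = (2 / a) ^+ n * (a / 2 * x ^+ 2) ^+ n.
  by rewrite -exprMn; congr (_ ^+ n); field; lra.
apply: ler_wpM2l; last exact: expn_le_expR.
by rewrite exprn_ge0 // divr_ge0 // ltW.
Qed.

Lemma oneDsqr_integrable : L1 (fun x => (1 + x ^+ 2)^-1).
Proof.
have m1 : measurable_fun setT (fun x : R => (1 + x ^+ 2)^-1).
  by apply: continuous_measurable_fun; exact: continuous_oneDsqrV.
have p (x : R) : 0 <= (1 + x ^+ 2)^-1.
  by rewrite invr_ge0; have := sqr_ge0 x; lra.
apply/integrableP; split; first exact/measurable_EFinP.
under eq_integral do rewrite /= ger0_norm //.
rewrite ge0_symfun_integralT //; last 2 first.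
- exact: continuous_oneDsqrV.
- by move=> x /=; rewrite sqrrN.
rewrite (_ : [set x | _] = `[0, +oo[%classic); last first.
  by apply/seteqP; split => x/=; rewrite in_itv/= andbT.
by rewrite integral0y_oneDsqr -EFinM ltry.
Qed.

Definition truncate (f : R -> R) (n : nat) (x : R) : R :=
  f x * \1_(`[- n%:R, n%:R]%classic : set R) x.

Lemma Rintegral_truncate f n : RI (truncate f n) =
  \int[mu]_(x in `[- n%:R, n%:R]) f x.
Proof.
rewrite [RHS]Rintegral_mkcond (_ : truncate f n = f \_ `[- n%:R, n%:R]) //.
apply/funext => x; rewrite /truncate /patch indicE.
by case: (_ \in _); rewrite ?mulr1 ?mulr0.
Qed.

Lemma truncate_norm_le f n x : `|truncate f n x| <= `|f x|.
Proof.
by rewrite /truncate indicE; case: (_ \in _); rewrite ?mulr1 ?mulr0 // normr0.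
Qed.

Lemma measurable_truncate f n :
  measurable_fun setT f -> measurable_fun setT (truncate f n).
Proof. by move=> mf; apply: measurable_funM => //; exact: measurable_indic. Qed.

Lemma truncate_cvg f x : truncate f n x @[n --> \oo] --> f x.
Proof.
apply: cvg_near_cst; near=> n.
rewrite /truncate indicE mem_setE in_itv /= -ler_norml.
rewrite (_ : `|x| <= n%:R) ?mulr1 //; near: n; exact: nbhs_infty_ger.
Unshelve. end_near. Qed.

Lemma Rintegral_truncate_cvg f : L1 f ->
  (fun n => RI (truncate f n)) @ \oo --> RI f.
Proof.
move=> intf; have mf := integrable_measurable intf.
apply: (Rintegral_dominated _ mf _ (integrable_normfun intf)).
- by move=> n; exact: measurable_truncate.
- by move=> x; exact: truncate_cvg.
- by move=> n x; exact: truncate_norm_le.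
Qed.

Lemma Rintegral_derive_eq0 (F f f' : R -> R) :
  (forall x : R, is_derive x 1 F (f x)) -> (forall x : R, is_derive x 1 f (f' x)) ->
  L1 f -> (fun n => F n%:R) @ \oo --> (0 : R) ->
  (fun n => F (- n%:R)) @ \oo --> (0 : R) -> RI f = 0.
Proof.
move=> dF df intf F1 F2.
suff h0 : (fun n => RI (truncate f n)) @ \oo --> (0 : R).
  have h := Rintegral_truncate_cvg intf.
  by rewrite -(cvg_lim _ h) // (cvg_lim _ h0).
(* Starting at n + 1 keeps the interval nondegenerate for the fundamental theorem of calculus. *)
rewrite -(cvg_shiftS (fun n => RI (truncate f n))).
suff -> : (fun n => RI (truncate f n.+1)) = (fun n => F n.+1%:R - F (- n.+1%:R)).
  move: F1 F2; rewrite -(cvg_shiftS (fun n => F n%:R)).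
  rewrite -(cvg_shiftS (fun n => F (- n%:R))) => F1 F2.
  by have := cvgB F1 F2; rewrite subr0; apply.
apply/funext => n; rewrite Rintegral_truncate /Rintegral.
have cF := is_derive_continuous dF.
rewrite (@continuous_FTC2 _ f F) //.
- have n0 : 0 < n.+1%:R :> R by rewrite ltr0n.
  lra.
- by apply: continuous_subspaceT; exact: is_derive_continuous df.
- split.
  + by move=> x _; exact: ex_derive.
  + by apply: cvg_at_right_filter; exact: cF.
  + by apply: cvg_at_left_filter; exact: cF.
- by move=> x _; rewrite derive1E; exact: derive_val.
Qed.

End line_integrals.

(** * The Fourier transform of a Gaussian and its moments *)

Section gaussian_transform.
Context {R : realType}.
Notation mu := (@lebesgue_measure R).
Local Notation L1 f := (mu.-integrable setT (EFin \o f)).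
Local Notation RI f := (Rintegral mu setT f).

Lemma norm_cos_le1 (x : R) : `|cos x| <= 1.
Proof. by rewrite ler_norml cos_geN1 cos_le1. Qed.

Lemma norm_sin_le1 (x : R) : `|sin x| <= 1.
Proof. by rewrite ler_norml sin_geN1 sin_le1. Qed.

Lemma integrable_mul_cos (h : R -> R) (x c : R) : L1 h ->
  L1 (fun w => h w * cos (w * x + c)).
Proof.
move=> inth; apply: integrable_mul_le1 => //; first measurable_auto.
by move=> w; exact: norm_cos_le1.
Qed.

(** The phase closes the family under differentiation: as -sin z = cos(z + pi/2), each derivative
    multiplies h by w and advances the phase by a quarter turn. *)
Lemma is_derive_cos_transform (h : R -> R) (c x : R) :
  L1 h -> L1 (fun w => w * h w) ->
  is_derive x 1 (fun x => RI (fun w => h w * cos (w * x + c)))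
    (RI (fun w => w * h w * cos (w * x + (c + pi / 2)))).
Proof.
move=> inth intwh.
pose f (x w : R) := h w * cos (w * x + c).
have df (t w : R) : is_derive t 1 (f ^~ w) (- (w * h w * sin (w * t + c))).
  by derive_auto => /=; ring.
have d1f t w : partial1of2 f t w = - (w * h w * sin (w * t + c)).
  by rewrite /partial1of2 derive1E; exact: derive_val.
have Ix : `]x - 1, x + 1[%classic x by rewrite /= in_itv /=; lra.
have intf t : `]x - 1, x + 1[%classic t -> L1 (f t).
  by move=> _; exact: integrable_mul_cos.
have derf (t w : R) : `]x - 1, x + 1[%classic t -> setT w -> derivable (f ^~ w) t 1.
  by move=> _ _; exact: ex_derive.
have dom t w : `]x - 1, x + 1[%classic t -> setT w ->
    `|partial1of2 f t w| <= `|w * h w|.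
  by move=> _ _; rewrite d1f normrN normrM ler_piMr // norm_sin_le1.
have intG := integrable_normfun intwh.
have D := derivable_under_integral measurableT Ix intf derf
  (fun w => normr_ge0 (w * h w)) intG dom.
have E := differentiation_under_integral measurableT Ix intf derf
  (fun w => normr_ge0 (w * h w)) intG dom.
apply: DeriveDef; first exact: D.
rewrite -derive1E [LHS]E; congr (Rintegral _ _ _); apply/funext => w.
by rewrite d1f addrA cosDpihalf mulrN.
Qed.

Context (a : R) (a0 : 0 < a).

(** The l-th derivative in x of a transform of exp(-a w^2): the cosine transform for c = 0, the sine
    transform for c = -pi/2. *)
Definition gauss_moment (l : nat) (c x : R) : R :=
  RI (fun w => w ^+ l * expR (- (a * w ^+ 2)) * cos (w * x + (c + l%:R * (pi / 2)))).

Lemma moment_integrable l : L1 (fun w : R => w ^+ l * expR (- (a * w ^+ 2))).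
Proof.
apply: integrable_dominated (expn_gauss_integrable l a0); first measurable_auto.
by move=> w; rewrite normrM normrX (ger0_norm (expR_ge0 _)).
Qed.

Lemma is_derive_gauss_moment l (c x : R) :
  is_derive x 1 (gauss_moment l c) (gauss_moment l.+1 c x).
Proof.
have h1 := moment_integrable l.
have h2 : L1 (fun w : R => w * (w ^+ l * expR (- (a * w ^+ 2)))).
  have := moment_integrable l.+1.
  by under eq_fun do rewrite exprS -mulrA.
apply: is_derive_eq.
  exact: (is_derive_cos_transform (c + l%:R * (pi / 2)) x h1 h2).
congr (Rintegral _ _ _); apply/funext => w.
by congr (_ * cos _); rewrite ?exprS; ring.
Qed.

(* Integrate the derivative in w of exp(-a w^2) sin(w x + c) over the line. *)
Lemma gauss_moment_ode c x : gauss_moment 1 c x = - (x / (2 * a)) * gauss_moment 0 c x.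
Proof.
pose F (w : R) := expR (- (a * w ^+ 2)) * sin (w * x + c).
pose f (w : R) := x * (w ^+ 0 * expR (- (a * w ^+ 2)) * cos (w * x + (c + 0%:R * (pi / 2))))
  + 2 * a * (w ^+ 1 * expR (- (a * w ^+ 2)) * cos (w * x + (c + 1%:R * (pi / 2)))).
have dF (w : R) : is_derive w 1 F (f w).
  have -> : f w = x * (expR (- (a * w ^+ 2)) * cos (w * x + c)) +
      2 * a * (w * expR (- (a * w ^+ 2)) * - sin (w * x + c)).
    by rewrite /f -cosDpihalf -addrA expr0 expr1 mul0r !mul1r addr0.
  by derive_auto => /=; ring.
have [f' df] : exists f' : R -> R, forall w : R, is_derive w 1 f (f' w).
  by eexists => w; repeat is_derive_step.
have i0 := integrable_mul_cos x (c + 0%:R * (pi / 2)) (moment_integrable 0).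
have i1 := integrable_mul_cos x (c + 1%:R * (pi / 2)) (moment_integrable 1).
have intf : L1 f.
  by apply: integrable_add; exact: integrable_scale.
(* Only vanishing of the boundary terms is needed, so exp z >= z replaces the true decay. *)
have Fbound (w : R) : 1 <= `|w| -> `|F w| <= (a * `|w|)^-1.
  move=> w1; rewrite /F normrM (ger0_norm (expR_ge0 _)).
  apply: (@le_trans _ _ (expR (- (a * w ^+ 2)))).
    by rewrite ler_piMr ?expR_ge0 // norm_sin_le1.
  rewrite expRN lef_pV2 ?posrE ?expR_gt0 //; last by rewrite mulr_gt0 //; lra.
  apply: le_trans (expR_ge1Dx _).
  have : a * `|w| <= a * w ^+ 2.
    rewrite ler_pM2l // -(@real_normK _ w) ?num_real // expr2; nra.
  lra.
have Fn0 (s : nat -> R) : (forall n, `|s n| = n%:R) -> (fun n => F (s n)) @ \oo --> (0 : R).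
  move=> sn.
  apply/cvgrPdist_le => e e0; near=> n; rewrite sub0r normrN.
  have n1 : 1 <= n%:R :> R by rewrite ler1n; near: n; exact: nbhs_infty_gt.
  apply: le_trans (Fbound _ _) _; rewrite sn //.
  rewrite -[leRHS]invrK lef_pV2 ?posrE ?invr_gt0 //; last by rewrite mulr_gt0 //; lra.
  rewrite -ler_pdivrMl // mulrC; near: n; exact: nbhs_infty_ger.
have := Rintegral_derive_eq0 dF df intf.
rewrite RintegralD //; [|exact: integrable_scale|exact: integrable_scale].
rewrite !RintegralZl // => H.
have {}H : x * gauss_moment 0 c x + 2 * a * gauss_moment 1 c x = 0.
  apply: H; apply: Fn0 => n; first by rewrite ger0_norm.
  by rewrite normrN ger0_norm.
have -> : gauss_moment 1 c x = (2 * a * gauss_moment 1 c x) / (2 * a) by field; rewrite gt_eqF.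
have -> : 2 * a * gauss_moment 1 c x = - (x * gauss_moment 0 c x) by lra.
by field; rewrite gt_eqF.
Unshelve. all: end_near. Qed.

(** By [gauss_moment_ode] the function solves y' = -(x/(2a)) y, so y exp(x^2/(4a)) is constant, and
    its value at 0 is a Gaussian integral. *)
Lemma gauss_moment0 c x :
  gauss_moment 0 c x = cos c * Num.sqrt (pi / a) * expR (- (x ^+ 2 / (4 * a))).
Proof.
pose H (x : R) := gauss_moment 0 c x * expR (x ^+ 2 / (4 * a)).
have dH (t : R) : is_derive t 1 H 0.
  have dE : is_derive t 1 (fun x : R => expR (x ^+ 2 / (4 * a)))
      (expR (t ^+ 2 / (4 * a)) * (t / (2 * a))).
    by derive_auto => /=; field; rewrite gt_eqF.
  apply: is_derive_eq.
    exact: (is_derive_mulfun (is_derive_gauss_moment 0 c t) dE).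
  by rewrite /= gauss_moment_ode; field; rewrite gt_eqF.
have := is_derive_0_is_cst x 0 dH.
rewrite /H expr0n mul0r expR0 mulr1 => E.
have : gauss_moment 0 c 0 = cos c * Num.sqrt (pi / a).
  rewrite -(Rintegral_gauss 0 a0) -RintegralZl //; last exact: gauss_integrable.
  congr (Rintegral _ _ _); apply/funext => w.
  by rewrite mulr0 add0r mul0r addr0 subr0 expr0 mul1r mulrC.
move=> <-; rewrite -E -mulrA -expRD subrr expR0 mulr1 //.
Qed.

Lemma derive1n_gauss_moment (k c : R) l :
  derive1n l (fun x => k * gauss_moment 0 c x) = (fun x => k * gauss_moment l c x).
Proof.
elim: l => [//|l IH]; rewrite derive1nS IH; apply/funext => x.
rewrite derive1E; have h := is_derive_gauss_moment l c x.
have hk := is_derive_mulfun (is_derive_constfun k x) h.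
by rewrite (@derive_val _ _ _ _ _ _ _ hk) mulr0 addr0.
Qed.

(* The phase -pi/2 turns the cosine into a sine. *)
Lemma gauss_moment_odd l x : gauss_moment l (- (pi / 2)) x = 0.
Proof.
suff -> : gauss_moment l (- (pi / 2)) = cst 0 by [].
elim: l => [|l IH]; apply/funext => {}x.
  by rewrite gauss_moment0 cosN cos_pihalf !mul0r.
have h := is_derive_gauss_moment l (- (pi / 2)) x.
by rewrite -(@derive_val _ _ _ _ _ _ _ h) IH derive_cst.
Qed.

End gaussian_transform.

(** * Fourier inversion *)

Section inversion.
Context {R : realType}.
Notation mu := (@lebesgue_measure R).
Local Notation L1 f := (mu.-integrable setT (EFin \o f)).
Local Notation RI f := (Rintegral mu setT f).

Lemma EFin_Rintegral (f : R -> R) : L1 f ->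
  (\int[mu]_x (f x)%:E = (RI f)%:E)%E.
Proof. by move=> intf; rewrite fineK //; exact: integrable_fin_num. Qed.

Lemma Rintegral_Fubini (F : R * R -> R) (p q : R -> R) :
  measurable_fun setT F -> (forall w x, `|F (w, x)| <= p w * q x) ->
  L1 p -> L1 q ->
  RI (fun w => RI (fun x => F (w, x))) = RI (fun x => RI (fun w => F (w, x))).
Proof.
move=> mF Fpq intp intq.
have mFw w : measurable_fun setT (fun x => F (w, x)).
  exact: (measurable_fun_pair2 w mF).
have mFx x : measurable_fun setT (fun w => F (w, x)).
  exact: (measurable_fun_pair1 x mF).
have iFw w : L1 (fun x => F (w, x)).
  by apply: (integrable_dominated _ _ (integrable_scale (p w) intq)); [exact: mFw|exact: Fpq].
have iFx x : L1 (fun w => F (w, x)).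
  apply: (integrable_dominated _ _ (integrable_scale (q x) intp)); first exact: mFx.
  by move=> w; rewrite mulrC; exact: Fpq.
have mFE : measurable_fun setT (EFin \o F) by exact/measurable_EFinP.
have intF : (mu \x mu)%E.-integrable setT (EFin \o F).
  apply/integrable12ltyP => //.
  apply: (@le_lt_trans _ _ (\int[mu]_w (RI q * p w)%:E)%E); last first.
    exact: (integrable_lty measurableT (integrable_scale (RI q) intp)).
  have Nle w : (\int[mu]_y `|(EFin \o F) (w, y)| <= (RI q * p w)%:E)%E.
    rewrite /= (EFin_Rintegral (integrable_normfun (iFw w))) lee_fin.
    rewrite mulrC -RintegralZl //; apply: Rintegral_le => //.
    - exact: integrable_normfun.
    - exact: integrable_scale.
  apply: ge0_le_integral => //.
  - by move=> w _; apply: integral_ge0.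
  - apply: (@measurable_fun_fubini_tonelli_F _ _ _ _ _ mu (abse \o (EFin \o F))) => //.
    by apply: measurableT_comp.
    by move=> z; exact: abse_ge0.
  - exact: (measurable_int _ (integrable_scale (RI q) intp)).
have := Fubini intF.
under eq_integral do rewrite /= (EFin_Rintegral (iFw _)).
under [in RHS]eq_integral do rewrite /= (EFin_Rintegral (iFx _)).
by rewrite /Rintegral => ->.
Qed.

(** For z >= 0 and 0 <= e <= 1, z e <= z^2 + e. *)
Lemma gauss_weight_integrable (f : R -> R) (c y : R) : 0 < c ->
  measurable_fun setT f -> L1 (fun x => f x ^+ 2) ->
  L1 (fun x => f x * expR (- (c * (x - y) ^+ 2))).
Proof.
move=> c0 mf intf2.
apply: integrable_dominated (integrable_add intf2 (gauss_integrable y c0)).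
  by measurable_auto.
move=> x; rewrite normrM (ger0_norm (expR_ge0 _)).
have e1 : expR (- (c * (x - y) ^+ 2)) <= 1.
  by rewrite expR_le1 oppr_le0 mulr_ge0 ?sqr_ge0 // ltW.
have := expR_ge0 (- (c * (x - y) ^+ 2)).
rewrite -(@real_normK _ (f x)) ?num_real //.
move: (expR _) e1 (normr_ge0 (f x)) => e e1; move: (`|f x|) => z z0 e0; nra.
Qed.

(* With K = k+1 and u = (x-y)^2, away from y the kernel is at most
   O(1/K) exp(-u/8), because K exp(-K^2 u/8) <= 8/(K u); its total mass is 2 pi. *)
Lemma approximate_identity (f : R -> R) (y : R) :
  {for y, continuous f} -> measurable_fun setT f -> L1 (fun x => f x ^+ 2) ->
  (fun k : nat => RI (fun x => f x *
     (k.+1%:R * Num.sqrt pi * expR (- (k.+1%:R ^+ 2 / 4 * (x - y) ^+ 2)))))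
    @ \oo --> (2 * pi * f y : R).
Proof.
move=> cf mf intf2; have pi0 := pi_gt0 R.
(* Half of the kernel's exponent is spent on smallness; the other half, at most -u/8 because K >= 1,
   stays as a weight independent of k that makes f - f y integrable. *)
pose M := RI (fun x => `|f x * expR (- (1 / 8 * (x - y) ^+ 2)) -
                        f y * expR (- (1 / 8 * (x - y) ^+ 2))|).
have intM : L1 (fun x => `|f x * expR (- (1 / 8 * (x - y) ^+ 2)) -
                        f y * expR (- (1 / 8 * (x - y) ^+ 2))|).
  apply: integrable_normfun; apply: integrable_sub.
    by apply: gauss_weight_integrable => //; lra.
  by apply: integrable_scale; apply: gauss_integrable; lra.
have M0 : 0 <= M by apply: Rintegral_ge0 => x _; exact: normr_ge0.
(* Near y the error is eta times the kernel mass 2 pi, that is e/2. *)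
apply/cvgrPdist_le => e e0; pose eta := e / (4 * pi).
have eta0 : 0 < eta by rewrite divr_gt0 // mulr_gt0.
have /cvgrPdist_le /(_ _ eta0) /nbhs_ballP [de /= de0 fde] := cf.
pose C := 8 * Num.sqrt pi / de ^+ 2.
have C0 : 0 <= C by rewrite divr_ge0 ?sqr_ge0 // mulr_ge0 ?sqrtr_ge0.
near=> k.
set K : R := k.+1%:R.
have K1 : 1 <= K by rewrite ler1n.
have K0 : 0 <= K by rewrite (le_trans _ K1).
have KC : C * M / K <= e / 2.
  rewrite ler_pdivrMr; last by lra.
  rewrite -ler_pdivrMl; last by lra.
  apply: (@le_trans _ _ k%:R); last by rewrite /K ler_nat.
  by near: k; exact: nbhs_infty_ger.
have K4 : 0 < K ^+ 2 / 4 by rewrite divr_gt0 // exprn_gt0; lra.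
pose N x := K * Num.sqrt pi * expR (- (K ^+ 2 / 4 * (x - y) ^+ 2)).
have intN : L1 N by apply: integrable_scale; exact: gauss_integrable.
have RIN : RI N = 2 * pi.
  rewrite RintegralZl //; last exact: gauss_integrable.
  rewrite Rintegral_gauss // -mulrA -sqrtrM; last by lra.
  have -> : pi * (pi / (K ^+ 2 / 4)) = (2 * pi / K) ^+ 2 by field; lra.
  rewrite sqrtr_sqr ger0_norm; last by rewrite divr_ge0 //; lra.
  by field; lra.
have N0 x : 0 <= N x.
  by rewrite mulr_ge0 ?expR_ge0 // mulr_ge0 ?sqrtr_ge0.
have intfN : L1 (fun x => f x * N x).
  have := integrable_scale (K * Num.sqrt pi) (gauss_weight_integrable y K4 mf intf2).
  by under eq_fun do rewrite mulrCA.
have -> : 2 * pi * f y - RI (fun x => f x * N x) = RI (fun x => f y * N x - f x * N x).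
  by rewrite RintegralB // ?RIN; [rewrite RintegralZl // RIN mulrC|exact: integrable_scale].
pose dom x := eta * N x + C / K * `|f x * expR (- (1 / 8 * (x - y) ^+ 2)) -
                        f y * expR (- (1 / 8 * (x - y) ^+ 2))|.
have intdom : L1 dom by apply: integrable_add; exact: integrable_scale.
apply: (@le_trans _ _ (RI dom)); last first.
  rewrite RintegralD //; [|exact: integrable_scale|exact: integrable_scale].
  rewrite (@RintegralZl _ _ _ mu setT N eta) // RIN.
  rewrite (@RintegralZl _ _ _ mu setT _ (C / K)) // -/M.
  have -> : eta * (2 * pi) = e / 2 by rewrite /eta; field; lra.
  have -> : C / K * M = C * M / K by rewrite mulrAC.
  by rewrite [leRHS](splitr e) lerD2l.
apply: Rintegral_norm_le => //.
  apply: integrable_measurable (integrable_sub _ intfN).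
  exact: (integrable_scale (f y) intN).
move=> x; rewrite -mulrBl normrM (ger0_norm (N0 x)) /dom -mulrBl normrM.
rewrite (ger0_norm (expR_ge0 _)) (distrC (f x)).
have [xde|xde] := ltP `|y - x| de.
  have h : `|f y - f x| <= eta by apply: fde.
  apply: ler_wpDr; last by rewrite ler_wpM2r.
  apply: mulr_ge0; first exact: divr_ge0.
  by apply: mulr_ge0 => //; exact: expR_ge0.
apply: ler_wpDl; first by rewrite mulr_ge0 // ltW.
rewrite [leRHS]mulrCA ler_wpM2l // /N.
set u := (x - y) ^+ 2.
have u0 : de ^+ 2 <= u.
  rewrite /u -(@real_normK _ (x - y)) ?num_real // distrC lerXn2r ?nnegrE //.
  by rewrite ltW.
have de2 : 0 < de ^+ 2 by rewrite exprn_gt0.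
have -> : - (K ^+ 2 / 4 * u) = - (K ^+ 2 / 8 * u) - (K ^+ 2 / 8 * u) by field.
rewrite expRD mulrA; apply: ler_pM; rewrite ?expR_ge0 //.
- by rewrite mulr_ge0 ?expR_ge0 // mulr_ge0 ?sqrtr_ge0.
- rewrite expRN ler_pdivrMr ?expR_gt0 //.
  have h : K ^+ 2 / 8 * u <= expR (K ^+ 2 / 8 * u).
    apply: le_trans (expR_ge1Dx _); lra.
  apply: (@le_trans _ _ (C / K * (K ^+ 2 / 8 * u))); last first.
    by rewrite ler_wpM2l // divr_ge0.
  have -> : C / K * (K ^+ 2 / 8 * u) = K * Num.sqrt pi * (u / de ^+ 2).
    by rewrite /C; field; rewrite !gt_eqF //; lra.
  apply: ler_peMr; first by rewrite mulr_ge0 ?sqrtr_ge0.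
  by rewrite ler_pdivlMr // mul1r.
- rewrite ler_expR lerN2 ler_wpM2r //; first by rewrite (le_trans _ u0) // ltW.
  by rewrite ler_pM2r ?invr_gt0 // exprn_ege1.
Unshelve. all: end_near. Qed.

End inversion.

(** * Gaussian-weighted inversion for integrable functions *)

Section inversion.
Context {R : realType}.
Notation mu := (@lebesgue_measure R).
Local Notation L1 f := (mu.-integrable setT (EFin \o f)).
Local Notation RI f := (Rintegral mu setT f).

Lemma measurable_Rintegral_param (F : R * R -> R) (q : R -> R) :
  measurable_fun setT F -> (forall w x, `|F (w, x)| <= q x) -> L1 q ->
  measurable_fun setT (fun w => RI (fun x => F (w, x))).
Proof.
move=> mF Fq intq.
have mFw w : measurable_fun setT (fun x => F (w, x)).
  exact: (measurable_fun_pair2 w mF).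
have iFw w : L1 (fun x => F (w, x)).
  by apply: (integrable_dominated _ _ intq); [exact: mFw|exact: Fq].
have mq := integrable_measurable intq.
(* Adding the majorant makes the integrand nonnegative, as Tonelli measurability asks; it changes
   the integral by a constant. *)
pose F' (z : R * R) := F z + q z.2.
have mF' : measurable_fun setT F'.
  apply: measurable_addfun => //; exact: (measurableT_comp mq).
have -> : (fun w => RI (fun x => F (w, x))) = (fun w => RI (fun x => F' (w, x)) + - RI q).
  by apply/funext => w; rewrite RintegralD // addrK.
apply: measurable_addfun; last exact: measurable_constfun.
apply: (measurableT_comp (f := fine)) => //.
apply: (@measurable_fun_fubini_tonelli_F _ _ _ _ _ mu (EFin \o F')).
  exact/measurable_EFinP.
move=> [w x] /=; rewrite lee_fin /F' /=; have := Fq w x.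
by rewrite ler_norml; lra.
Qed.

(* The real part of the Fourier integral of h1 + i h2; its imaginary part is
   [cos_part h2 (- h1)]. *)
Definition cos_part (h1 h2 : R -> R) (w : R) : R :=
  RI (fun x => h1 x * cos (w * x) + h2 x * sin (w * x)).

Lemma cos_sin_integrable (h1 h2 : R -> R) (w y : R) : L1 h1 -> L1 h2 ->
  L1 (fun x => h1 x * cos (w * (x - y)) + h2 x * sin (w * (x - y))).
Proof.
move=> i1 i2; apply: integrable_add.
  by apply: integrable_mul_le1 => //; [measurable_auto|move=> x; exact: norm_cos_le1].
by apply: integrable_mul_le1 => //; [measurable_auto|move=> x; exact: norm_sin_le1].
Qed.

(** The real part of exp(iwy) times the Fourier integral of h1 + i h2: the factor moves under the
    integral and shifts x to x - y. *)
Lemma cos_part_rotate (h1 h2 : R -> R) (w y : R) : L1 h1 -> L1 h2 ->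
  cos_part h1 h2 w * cos (w * y) - cos_part h2 (fun x => - h1 x) w * sin (w * y) =
  RI (fun x => h1 x * cos (w * (x - y)) + h2 x * sin (w * (x - y))).
Proof.
move=> i1 i2; have i1N := integrable_opp i1.
have p1 := cos_sin_integrable w 0 i1 i2.
have p2 := cos_sin_integrable w 0 i2 i1N.
have E (k1 k2 : R -> R) : (fun x => k1 x * cos (w * (x - 0)) + k2 x * sin (w * (x - 0))) =
   (fun x => k1 x * cos (w * x) + k2 x * sin (w * x)).
  by apply/funext => x; rewrite subr0.
rewrite !E in p1 p2.
rewrite /cos_part -(RintegralZr _ measurableT p1) -(RintegralZr _ measurableT p2).
have scaler k f : L1 f -> L1 (fun x => f x * k).
  by move=> fi; have := integrableZr measurableT k fi.
rewrite -(RintegralB measurableT (scaler _ _ p1) (scaler _ _ p2)).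
congr (Rintegral _ _ _); apply/funext => x.
by rewrite mulrBr cosB sinB; ring.
Qed.

Lemma cos_part_measurable (h1 h2 : R -> R) : L1 h1 -> L1 h2 ->
  measurable_fun setT (cos_part h1 h2).
Proof.
move=> i1 i2; have [m1 m2] := (integrable_measurable i1, integrable_measurable i2).
have dom := integrable_add (integrable_normfun i1) (integrable_normfun i2).
apply: (@measurable_Rintegral_param
  (fun z => h1 z.2 * cos (z.1 * z.2) + h2 z.2 * sin (z.1 * z.2)) _ _ _ dom).
  have n1 := measurableT_comp m1 (@measurable_sndfun _ _ R R).
  have n2 := measurableT_comp m2 (@measurable_sndfun _ _ R R).
  by measurable_auto.
move=> w x /=; apply: le_trans (ler_normD _ _) _.
by rewrite !normrM lerD // ler_piMr // ?norm_cos_le1 ?norm_sin_le1.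
Qed.

(** After the exchange of integrals the inner one is a [gauss_moment] of order 0: phase 0 gives the
    kernel next to h1, phase -pi/2 kills the term with h2. *)
Lemma gauss_weighted_inversion (h1 h2 : R -> R) (s y : R) : 0 < s ->
  L1 h1 -> L1 h2 ->
  RI (fun w => expR (- (s * w ^+ 2)) *
     (cos_part h1 h2 w * cos (w * y) - cos_part h2 (fun x => - h1 x) w * sin (w * y))) =
  RI (fun x => h1 x * (Num.sqrt (pi / s) * expR (- ((x - y) ^+ 2 / (4 * s))))).
Proof.
move=> s0 i1 i2.
have [m1 m2] := (integrable_measurable i1, integrable_measurable i2).
have dom := integrable_add (integrable_normfun i1) (integrable_normfun i2).
have gs : L1 (fun w : R => expR (- (s * w ^+ 2))).
  have := gauss_integrable 0 s0; by under eq_fun do rewrite subr0.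
pose F (z : R * R) := expR (- (s * z.1 ^+ 2)) *
   (h1 z.2 * cos (z.1 * (z.2 - y)) + h2 z.2 * sin (z.1 * (z.2 - y))).
have mF : measurable_fun setT F.
  have n1 := measurableT_comp m1 (@measurable_sndfun _ _ R R).
  have n2 := measurableT_comp m2 (@measurable_sndfun _ _ R R).
  by rewrite /F; measurable_auto.
have bF w x : `|F (w, x)| <= expR (- (s * w ^+ 2)) * (`|h1 x| + `|h2 x|).
  rewrite /F normrM (ger0_norm (expR_ge0 _)) ler_wpM2l ?expR_ge0 //=.
  apply: le_trans (ler_normD _ _) _.
  by rewrite !normrM lerD // ler_piMr // ?norm_cos_le1 ?norm_sin_le1.
transitivity (RI (fun w => RI (fun x => F (w, x)))).
  congr (Rintegral _ _ _); apply/funext => w.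
  by rewrite cos_part_rotate // -RintegralZl //; exact: cos_sin_integrable.
rewrite (Rintegral_Fubini mF bF gs dom).
congr (Rintegral _ _ _); apply/funext => x.
pose Ec (c w : R) := expR (- (s * w ^+ 2)) * cos (w * (x - y) + c).
have iE c : L1 (Ec c) by exact: integrable_mul_cos.
have RIE c : RI (Ec c) = cos c * Num.sqrt (pi / s) * expR (- ((x - y) ^+ 2 / (4 * s))).
  rewrite -(gauss_moment0 s0); congr (Rintegral _ _ _); apply/funext => w.
  by rewrite expr0 mul1r mul0r addr0.
have -> : (fun w => F (w, x)) = (fun w => h1 x * Ec 0 w + h2 x * Ec (- (pi / 2)) w).
  by apply/funext => w; rewrite /F /Ec /= addr0 cosBpihalf; ring.
rewrite RintegralD //; [|exact: integrable_scale|exact: integrable_scale].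
by rewrite !RintegralZl // !RIE cosN cos_pihalf cos0 !mul0r mulr0 addr0 mul1r.
Qed.

End inversion.

(** * Passage from truncations to square integrable functions *)

Section inversion.
Context {R : realType}.
Notation mu := (@lebesgue_measure R).
Local Notation L1 f := (mu.-integrable setT (EFin \o f)).
Local Notation RI f := (Rintegral mu setT f).

Lemma truncate_integrable (f : R -> R) n : measurable_fun setT f ->
  L1 (fun x => f x ^+ 2) -> L1 (truncate f n).
Proof.
move=> mf intf2.
have i1 := @integrable_indic_itv R (- n%:R) n%:R true false.
apply: (integrable_dominated _ _ (integrable_add intf2 i1)).
  exact: measurable_truncate.
move=> x; rewrite /truncate indicE; case: (_ \in _) => /=.
  rewrite mulr1 -(@real_normK _ (f x)) ?num_real //.
  have := sqr_ge0 (`|f x| - 1); have := sqr_ge0 (`|f x|); lra.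
by rewrite mulr0 normr0 addr0 sqr_ge0.
Qed.

(** The square of the L2 distance in [has_fourier_L2], written with real and imaginary parts. *)
Definition fourier_defect (f1 f2 g1 g2 : R -> R) (n : nat) : \bar R :=
  (\int[mu]_w ((cos_part (truncate f1 n) (truncate f2 n) w - g1 w) ^+ 2 +
     (cos_part (truncate f2 n) (fun x => - truncate f1 n x) w - g2 w) ^+ 2)%:E)%E.

Section weighted.
Variables (f1 f2 g1 g2 : R -> R) (y : R).
Hypotheses (mf1 : measurable_fun setT f1) (mf2 : measurable_fun setT f2).
Hypotheses (if1 : L1 (fun x => f1 x ^+ 2)) (if2 : L1 (fun x => f2 x ^+ 2)).
Hypotheses (ig1 : L1 g1) (ig2 : L1 g2).
Hypothesis defect0 : fourier_defect f1 f2 g1 g2 n @[n --> \oo] --> 0%E.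

Let G w := g1 w * cos (w * y) - g2 w * sin (w * y).

Lemma inversion_integrand_integrable : L1 G.
Proof.
apply: integrable_sub.
  by apply: integrable_mul_le1 => //; [measurable_auto|move=> x; exact: norm_cos_le1].
by apply: integrable_mul_le1 => //; [measurable_auto|move=> x; exact: norm_sin_le1].
Qed.

Let Gn n w := cos_part (truncate f1 n) (truncate f2 n) w * cos (w * y) -
  cos_part (truncate f2 n) (fun x => - truncate f1 n x) w * sin (w * y).

(** Cauchy-Schwarz against the square integrable weight, carried out as a pointwise
    arithmetic-geometric inequality with parameter [eta]. *)
Lemma weighted_transform_cvg (s : R) : 0 < s ->
  (fun n => RI (fun w : R => expR (- (s * w ^+ 2)) * Gn n w)) @ \oo -->
  RI (fun w : R => expR (- (s * w ^+ 2)) * G w).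
Proof.
move=> s0; have intG := inversion_integrand_integrable.
have mE : measurable_fun setT (fun w : R => expR (- (s * w ^+ 2))) by measurable_auto.
have E1 (w : R) : `|expR (- (s * w ^+ 2))| <= 1.
  by rewrite ger0_norm ?expR_ge0 // expR_le1 oppr_le0 mulr_ge0 ?sqr_ge0 // ltW.
have intEG : L1 (fun w : R => expR (- (s * w ^+ 2)) * G w).
  by have := integrable_mul_le1 intG mE E1; under eq_fun do rewrite mulrC.
have iE2 : L1 (fun w : R => expR (- (s * w ^+ 2)) ^+ 2).
  have s2 : 0 < 2 * s by lra.
  have := gauss_integrable 0 s2.
  rewrite (_ : (fun x => _) = (fun w : R => expR (- (s * w ^+ 2)) ^+ 2)) //.
  by apply/funext => w; rewrite -expRM_natl subr0; congr expR; ring.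
pose B := RI (fun w : R => expR (- (s * w ^+ 2)) ^+ 2).
have B0 : 0 <= B by apply: Rintegral_ge0 => w _; exact: sqr_ge0.
(* The weight contributes eta B <= e/2, and a defect of at most eta e contributes (2 eta)^-1 (eta e)
   = e/2; B + 1 is positive even if B were 0. *)
apply/cvgrPdist_le => e e0; pose eta := e / (2 * (B + 1)).
have eta0 : 0 < eta by rewrite divr_gt0 //; lra.
have ee0 : 0 < eta * e by rewrite mulr_gt0.
near=> n.
pose d1 w := cos_part (truncate f1 n) (truncate f2 n) w - g1 w.
pose d2 w := cos_part (truncate f2 n) (fun x => - truncate f1 n x) w - g2 w.
have i1 := truncate_integrable n mf1 if1.
have i2 := truncate_integrable n mf2 if2.
have m1 : measurable_fun setT d1.
  apply: measurable_addfun; first exact: cos_part_measurable.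
  by apply: measurable_oppfun; exact: integrable_measurable ig1.
have m2 : measurable_fun setT d2.
  apply: measurable_addfun; first by apply: cos_part_measurable => //; exact: integrable_opp.
  by apply: measurable_oppfun; exact: integrable_measurable ig2.
have defect_le : (fourier_defect f1 f2 g1 g2 n <= (eta * e)%:E)%E.
  near: n; move: defect0 => /fine_cvgP[fin /cvgrPdist_le /(_ _ ee0)] h.
  near=> n; have finn : fourier_defect f1 f2 g1 g2 n \is a fin_num by near: n.
  rewrite -(fineK finn) lee_fin.
  have : `|0 - fine (fourier_defect f1 f2 g1 g2 n)| <= eta * e by near: n.
  by rewrite sub0r normrN; apply: le_trans; exact: ler_norm.
have mD : measurable_fun setT (fun w => d1 w ^+ 2 + d2 w ^+ 2) by measurable_auto.
have D0 w : 0 <= d1 w ^+ 2 + d2 w ^+ 2 by rewrite addr_ge0 ?sqr_ge0.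
have iD : L1 (fun w => d1 w ^+ 2 + d2 w ^+ 2).
  apply/integrableP; split; first exact/measurable_EFinP.
  under eq_integral do rewrite /= ger0_norm //.
  exact: le_lt_trans defect_le (ltry _).
have RID : RI (fun w => d1 w ^+ 2 + d2 w ^+ 2) <= eta * e.
  by rewrite -lee_fin -EFin_Rintegral.
pose dom (w : R) := eta * expR (- (s * w ^+ 2)) ^+ 2 + (2 * eta)^-1 * (d1 w ^+ 2 + d2 w ^+ 2).
have idom : L1 dom by apply: integrable_add; exact: integrable_scale.
have mdiff : measurable_fun setT (fun w : R =>
    expR (- (s * w ^+ 2)) * (d1 w * cos (w * y) - d2 w * sin (w * y))).
  by measurable_auto.
have diff_le (w : R) :
    `|expR (- (s * w ^+ 2)) * (d1 w * cos (w * y) - d2 w * sin (w * y))| <= dom w.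
  rewrite normrM (ger0_norm (expR_ge0 _)).
  apply: (@le_trans _ _ (expR (- (s * w ^+ 2)) * (`|d1 w| + `|d2 w|))).
    rewrite ler_wpM2l ?expR_ge0 //; apply: le_trans (ler_normB _ _) _.
    by rewrite !normrM lerD // ler_piMr // ?norm_cos_le1 ?norm_sin_le1.
  rewrite /dom -(@real_normK _ (d1 w)) ?num_real // -(@real_normK _ (d2 w)) ?num_real //.
  move: (expR _) (`|d1 w|) (`|d2 w|) => E z1 z2.
  (* AM-GM: E z <= (eta E^2 + z^2 / eta) / 2 *)
  have -> : eta * E ^+ 2 + (2 * eta)^-1 * (z1 ^+ 2 + z2 ^+ 2) = E * (z1 + z2) +
     (2 * eta)^-1 * ((eta * E - z1) ^+ 2 + (eta * E - z2) ^+ 2).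
    by field; rewrite gt_eqF.
  by rewrite lerDl mulr_ge0 ?invr_ge0 ?addr_ge0 ?sqr_ge0 // mulr_ge0 // ltW.
have idiff : L1 (fun w : R =>
    expR (- (s * w ^+ 2)) * (d1 w * cos (w * y) - d2 w * sin (w * y))).
  by apply: (integrable_dominated _ _ idom); [exact: mdiff|exact: diff_le].
have -> : (fun w : R => expR (- (s * w ^+ 2)) * Gn n w) =
    (fun w : R => expR (- (s * w ^+ 2)) * G w +
    expR (- (s * w ^+ 2)) * (d1 w * cos (w * y) - d2 w * sin (w * y))).
  by apply/funext => w; rewrite /Gn /G /d1 /d2; ring.
rewrite RintegralD // opprD addrA subrr sub0r normrN.
apply: (@le_trans _ _ (RI dom)); first exact: Rintegral_norm_le.
rewrite RintegralD //; [|exact: integrable_scale|exact: integrable_scale].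
rewrite (@RintegralZl _ _ _ mu setT _ eta) //.
rewrite (@RintegralZl _ _ _ mu setT _ (2 * eta)^-1) // -/B.
have h1 : eta * B <= e / 2.
  have -> : e / 2 = eta * (B + 1) by rewrite /eta; field; lra.
  by rewrite ler_pM2l //; lra.
have h2 : (2 * eta)^-1 * RI (fun w => d1 w ^+ 2 + d2 w ^+ 2) <= e / 2.
  have -> : e / 2 = (2 * eta)^-1 * (eta * e) by field; rewrite gt_eqF.
  by rewrite ler_wpM2l // invr_ge0 mulr_ge0 // ltW.
by rewrite [leRHS](splitr e) lerD.
Unshelve. all: end_near. Qed.

(** Both sides are limits of [gauss_weighted_inversion] for the truncations: the left by dominated
    convergence, the right by [weighted_transform_cvg]. *)
Lemma weighted_inversion (s : R) : 0 < s ->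
  RI (fun x => f1 x * (Num.sqrt (pi / s) * expR (- ((x - y) ^+ 2 / (4 * s))))) =
  RI (fun w : R => expR (- (s * w ^+ 2)) * G w).
Proof.
move=> s0; have L := weighted_transform_cvg s0.
have s4 : 0 < (4 * s)^-1 by rewrite invr_gt0; lra.
pose N x := Num.sqrt (pi / s) * expR (- ((x - y) ^+ 2 / (4 * s))).
have NE x : N x = Num.sqrt (pi / s) * expR (- ((4 * s)^-1 * (x - y) ^+ 2)).
  by rewrite /N [_ / (4 * s)]mulrC.
have iN : L1 (fun x => f1 x * N x).
  have := integrable_scale (Num.sqrt (pi / s)) (gauss_weight_integrable y s4 mf1 if1).
  by under eq_fun do rewrite mulrCA -NE.
have N0 x : 0 <= N x by rewrite mulr_ge0 ?expR_ge0 ?sqrtr_ge0.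
have mN : measurable_fun setT N by rewrite /N; measurable_auto.
have L' : (fun n => RI (fun x => truncate f1 n x * N x)) @ \oo --> RI (fun x => f1 x * N x).
  apply: (Rintegral_dominated _ _ _ (integrable_normfun iN)).
  - by move=> n; apply: measurable_mulfun => //; exact: measurable_truncate.
  - by apply: measurable_mulfun.
  - by move=> x; apply: cvgM; [exact: truncate_cvg|exact: cvg_cst].
  - by move=> n x; rewrite (normrM (truncate f1 n x)) (normrM (f1 x) (N x));
    rewrite ler_wpM2r // truncate_norm_le.
suff E : (fun n => RI (fun x => truncate f1 n x * N x)) =
    (fun n => RI (fun w : R => expR (- (s * w ^+ 2)) * Gn n w)).
  by rewrite E in L'; rewrite -(cvg_lim _ L') // (cvg_lim _ L).
apply/funext => n.
exact: (esym (gauss_weighted_inversion y s0 (truncate_integrable n mf1 if1)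
  (truncate_integrable n mf2 if2))).
Qed.

Lemma fourier_inversion : {for y, continuous f1} -> 2 * pi * f1 y = RI G.
Proof.
move=> cf; have L := approximate_identity cf mf1 if1.
have intG := inversion_integrand_integrable.
(* The choice s = (k+1)^(-2) turns the kernel of [weighted_inversion] into that of
   [approximate_identity]. *)
have L' : (fun k : nat => RI (fun w => expR (- (k.+1%:R ^- 2 * w ^+ 2)) * G w)) @ \oo --> RI G.
  apply: (Rintegral_dominated _ _ _ (integrable_normfun intG)).
  - move=> k; apply: measurable_mulfun; [measurable_auto|exact: integrable_measurable intG].
  - exact: integrable_measurable intG.
  - move=> w; rewrite -[X in _ --> X]mul1r; apply: cvgM; last exact: cvg_cst.
    apply/cvgrPdist_le => e e0; near=> k.
    have e1 : expR (- (k.+1%:R ^- 2 * w ^+ 2)) <= 1.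
      by rewrite expR_le1 oppr_le0 mulr_ge0 ?sqr_ge0 // invr_ge0 sqr_ge0.
    rewrite ger0_norm ?subr_ge0 // lerBlDl -lerBlDr.
    apply: le_trans (expR_ge1Dx _); rewrite lerD2l lerN2.
    have k1 : 1 <= k.+1%:R :> R by rewrite ler1n.
    rewrite mulrC ler_pdivrMr; last by rewrite exprn_gt0 // (lt_le_trans _ k1).
    rewrite -ler_pdivrMl //; apply: (@le_trans _ _ k%:R).
      by near: k; exact: nbhs_infty_ger.
    apply: (@le_trans _ _ k.+1%:R); first by rewrite ler_nat.
    by rewrite expr2 ler_peMr // (le_trans _ k1).
  - move=> k w; rewrite normrM ler_piMl // ger0_norm ?expR_ge0 // expR_le1 oppr_le0.
    by rewrite mulr_ge0 ?sqr_ge0 // invr_ge0 sqr_ge0.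
suff E : (fun k : nat => RI (fun x => f1 x *
     (k.+1%:R * Num.sqrt pi * expR (- (k.+1%:R ^+ 2 / 4 * (x - y) ^+ 2))))) =
    (fun k : nat => RI (fun w => expR (- (k.+1%:R ^- 2 * w ^+ 2)) * G w)).
  by rewrite E in L; rewrite -(cvg_lim _ L) // (cvg_lim _ L').
apply/funext => k; have K0 : 0 < k.+1%:R :> R by rewrite ltr0n.
rewrite -weighted_inversion ?invr_gt0 ?exprn_gt0 //.
congr (Rintegral _ _ _); apply/funext => x; congr (_ * (_ * _)).
  by rewrite invrK sqrtrM ?pi_ge0 // sqrtr_sqr ger0_norm ?(ltW K0) // mulrC.
by congr expR; field; rewrite gt_eqF.
Unshelve. all: end_near. Qed.

End weighted.
End inversion.

Local Open Scope complex_scope.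

(** * Inversion for complex-valued functions *)

Section complex_transform.
Context {R : realType}.
Notation mu := (@lebesgue_measure R).
Local Notation L1 f := (mu.-integrable setT (EFin \o f)).
Local Notation RI f := (Rintegral mu setT f).
Local Notation Re := complex.Re.
Local Notation Im := complex.Im.
Local Notation ReF f := (fun x => complex.Re (f x)).
Local Notation ImF f := (fun x => complex.Im (f x)).

Lemma normcE (z : R[i]) : Normc.normc z = Num.sqrt (Re z ^+ 2 + Im z ^+ 2).
Proof. by case: z. Qed.

Lemma sqr_normc_ReIm (z : R[i]) : Normc.normc z ^+ 2 = Re z ^+ 2 + Im z ^+ 2.
Proof. by rewrite normcE sqr_sqrtr // addr_ge0 ?sqr_ge0. Qed.

Lemma normc_le_ReIm (z : R[i]) : Normc.normc z <= `|Re z| + `|Im z|.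
Proof.
rewrite -(@ler_pXn2r _ 2) ?nnegrE ?addr_ge0 //; last by rewrite normcE sqrtr_ge0.
rewrite sqr_normc_ReIm -(@real_normK _ (Re z)) ?num_real //.
rewrite -(@real_normK _ (Im z)) ?num_real //.
have : 0 <= `|Re z| * `|Im z| by rewrite mulr_ge0.
lra.
Qed.

Lemma norm_Re_le (z : R[i]) : `|Re z| <= Normc.normc z.
Proof.
rewrite -(@ler_pXn2r _ 2) ?nnegrE //; last by rewrite normcE sqrtr_ge0.
by rewrite sqr_normc_ReIm real_normK ?num_real // lerDl sqr_ge0.
Qed.

Lemma norm_Im_le (z : R[i]) : `|Im z| <= Normc.normc z.
Proof.
rewrite -(@ler_pXn2r _ 2) ?nnegrE //; last by rewrite normcE sqrtr_ge0.
by rewrite sqr_normc_ReIm real_normK ?num_real // lerDr sqr_ge0.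
Qed.

Lemma L2norm_sqr (f : R -> R[i]) :
  (L2norm f `^ 2 = \int[mu]_x (Re (f x) ^+ 2 + Im (f x) ^+ 2)%:E)%E.
Proof.
rewrite /L2norm poweR_Lnorm //; apply: eq_integral => x _.
rewrite /= ger0_norm; last by rewrite normcE sqrtr_ge0.
by rewrite powR_mulrn ?sqr_normc_ReIm // normcE sqrtr_ge0.
Qed.

Lemma in_L2_integrable (f : R -> R[i]) : in_L2 f ->
  L1 (fun x => Re (f x) ^+ 2) /\ L1 (fun x => Im (f x) ^+ 2).
Proof.
move=> [mr mi fin].
have mRI : measurable_fun setT (fun x => Re (f x) ^+ 2 + Im (f x) ^+ 2).
  by apply: measurable_addfun; exact: measurable_expfun.
have i : L1 (fun x => Re (f x) ^+ 2 + Im (f x) ^+ 2).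
  apply/integrableP; split; first exact/measurable_EFinP.
  under eq_integral do rewrite /= ger0_norm ?addr_ge0 ?sqr_ge0 //.
  by rewrite -L2norm_sqr poweR_lty.
split; apply: (integrable_dominated _ _ i).
- exact: measurable_expfun.
- by move=> x; rewrite ger0_norm ?sqr_ge0 // lerDl sqr_ge0.
- exact: measurable_expfun.
- by move=> x; rewrite ger0_norm ?sqr_ge0 // lerDr sqr_ge0.
Qed.

Lemma fourier_truncate (f : R -> R[i]) (n : nat) (w : R) :
  fourier (restrict_sym f n) w =
  cos_part (truncate (ReF f) n) (truncate (ImF f) n) w +i*
  cos_part (truncate (ImF f) n) (fun x => - truncate (ReF f) n x) w.
Proof.
rewrite /fourier /cos_part; congr (_ +i* _);
  congr (Rintegral _ _ _); apply/funext => x;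
  rewrite /restrict_sym /expi /truncate cosN sinN /=;
  case: (f x) => a b /=; ring.
Qed.

Lemma fourier_L2_defect (f g : R -> R[i]) : has_fourier_L2 f g ->
  fourier_defect (ReF f) (ImF f) (ReF g) (ImF g) n @[n --> \oo] --> 0%E.
Proof.
move=> [_ _ /fine_cvgP [fin cv]].
have E n : fourier_defect (ReF f) (ImF f) (ReF g) (ImF g) n =
    (L2norm (fun w => (fourier (restrict_sym f n) w - g w)%R) `^ 2)%E.
  rewrite L2norm_sqr; apply: eq_integral => w _; rewrite fourier_truncate.
  by case: (g w) => a b.
have E2 (x : \bar R) : x \is a fin_num -> (0 <= x)%E -> (x `^ 2 = (fine x ^+ 2)%:E)%E.
  by case: x => // r _; rewrite lee_fin /= => r0; rewrite powR_mulrn.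
have N0 n : (0 <= L2norm (fun w => (fourier (restrict_sym f n) w - g w)%R))%E.
  exact: Lnorm_ge0.
apply/fine_cvgP; split.
  by near=> n; rewrite E E2 //; near: n.
have cv2 := cvgM cv cv _; rewrite mulr0 in cv2.
apply: cvg_trans (cv2 _); apply: near_eq_cvg; near=> n.
by rewrite /= E E2 //=; near: n; exact: fin.
Unshelve. all: end_near. Qed.

Lemma continuous_ReIm (f : R -> R[i]) (y : R) : continuous (f : R -> R[i]^o) ->
  {for y, continuous (ReF f)} /\ {for y, continuous (ImF f)}.
Proof.
move=> /(_ y) /cvgrPdist_lt cf.
have near_lt (e : R) : 0 < e -> \forall t \near nbhs y, Normc.normc (f y - f t) < e.
  move=> e0; have eC : (0 : R[i]) < e%:C by rewrite ltcR.
  have := cf _ eC; apply: filterS => t.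
  by rewrite normc_def -normcE ltcR.
split; apply/cvgrPdist_lt => e /near_lt; apply: filterS => t; apply: le_lt_trans.
  by have := norm_Re_le (f y - f t); case: (f y) => ? ?; case: (f t).
by have := norm_Im_le (f y - f t); case: (f y) => ? ?; case: (f t).
Qed.

Lemma cos_partN (h1 h2 : R -> R) (w : R) : L1 h1 -> L1 h2 ->
  cos_part (fun x => - h1 x) (fun x => - h2 x) w = - cos_part h1 h2 w.
Proof.
move=> i1 i2; have := cos_sin_integrable w 0 i1 i2.
under eq_fun do rewrite subr0; move=> i.
rewrite /cos_part -mulN1r -RintegralZl //.
by congr (Rintegral _ _ _); apply/funext => x; ring.
Qed.

(** The imaginary part comes from the real statement for -i f and -i g; multiplication by -i leaves
    the defect unchanged. *)
Lemma complex_fourier_inversion (f g : R -> R[i]) (y : R) :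
  has_fourier_L2 f g -> continuous (f : R -> R[i]^o) ->
  L1 (ReF g) -> L1 (ImF g) ->
  2 * pi * Re (f y) = RI (fun w => Re (g w * expi (w * y))) /\
  2 * pi * Im (f y) = RI (fun w => Im (g w * expi (w * y))).
Proof.
move=> fg cf ig1 ig2; have [L2f _ _] := fg; have [mf1 mf2 _] := L2f.
have [if1 if2] := in_L2_integrable L2f.
have d := fourier_L2_defect fg.
have [c1 c2] := continuous_ReIm y cf.
have m1N : measurable_fun setT (fun x => - Re (f x)) by apply: measurable_oppfun.
have if1N : L1 (fun x => (- Re (f x)) ^+ 2).
  by under eq_fun do rewrite sqrrN.
have d' : fourier_defect (ImF f) (fun x => - Re (f x)) (ImF g) (fun w => - Re (g w)) n
    @[n --> \oo] --> 0%E.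
  suff E : fourier_defect (ImF f) (fun x => - Re (f x)) (ImF g) (fun w => - Re (g w)) =
     fourier_defect (ReF f) (ImF f) (ReF g) (ImF g) by rewrite E.
  apply/funext => n; apply: eq_integral => w _; congr (_%:E).
  have -> : truncate (fun x => - Re (f x)) n = (fun x => - truncate (ReF f) n x).
    by apply/funext => x; rewrite /truncate /= mulNr.
  rewrite cos_partN; [|exact: truncate_integrable|exact: truncate_integrable].
  by ring.
split.
  rewrite (fourier_inversion mf1 mf2 if1 if2 ig1 ig2 d c1).
  congr (Rintegral _ _ _); apply/funext => w.
  by rewrite /expi; case: (g w).
rewrite (fourier_inversion mf2 m1N if2 if1N ig2 (integrable_opp ig1) d' c2).
congr (Rintegral _ _ _); apply/funext => w.
by rewrite /expi; case: (g w) => a b /=; ring.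
Qed.

End complex_transform.

(** * Framelets and Gaussian derivatives *)

Section approximation.
Context {R : realType}.
Notation mu := (@lebesgue_measure R).
Local Notation L1 f := (mu.-integrable setT (EFin \o f)).
Local Notation RI f := (Rintegral mu setT f).
Local Notation Re := complex.Re.
Local Notation Im := complex.Im.

Lemma expiD (s t : R) : expi (s + t) = expi s * expi t.
Proof.
rewrite /expi cosD sinD; apply/eqP.
by rewrite eq_complex /= (addrC (sin s * _)) (mulrC (sin s)) !eqxx.
Qed.

Lemma exp_i_expi l : 'i%C ^+ l = expi (l%:R * (pi / 2) : R).
Proof.
elim: l => [|l IH]; first by rewrite expr0 mul0r /expi cos0 sin0.
have -> : l.+1%:R * (pi / 2) = l%:R * (pi / 2) + pi / 2 :> R by ring.
by rewrite exprSr IH expiD; congr (_ * _); rewrite /expi cos_pihalf sin_pihalf.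
Qed.

Lemma psi_hat_rotate m l (w y : R) : psi_hat m l w * expi (w * y) =
  expi (w * (y - jpar R m / 2) + l%:R * (pi / 2)) * (framelet_symbol m l (w / 4))%:C.
Proof.
rewrite /psi_hat exp_i_expi -/(framelet_symbol m l (w / 4)) mulrAC; congr (_ * _).
by rewrite -!expiD; congr expi; ring.
Qed.

Lemma Re_psi_hat_rotate m l (w y : R) : Re (psi_hat m l w * expi (w * y)) =
  framelet_symbol m l (w / 4) * cos (w * (y - jpar R m / 2) + l%:R * (pi / 2)).
Proof. by rewrite psi_hat_rotate /expi /=; ring. Qed.

Lemma Im_psi_hat_rotate m l (w y : R) : Im (psi_hat m l w * expi (w * y)) =
  framelet_symbol m l (w / 4) * sin (w * (y - jpar R m / 2) + l%:R * (pi / 2)).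
Proof. by rewrite psi_hat_rotate /expi /=; ring. Qed.

Lemma normc_psi_hat m l (w : R) :
  Normc.normc (psi_hat m l w) = `|framelet_symbol m l (w / 4)|.
Proof.
have := psi_hat_rotate m l w 0; rewrite mulr0 {1}/expi cos0 sin0 mulr1 => ->.
rewrite normcE -[RHS]sqrtr_sqr; congr Num.sqrt.
rewrite /expi /=; set c := cos _; set s := sin _; set F := framelet_symbol _ _ _.
have cs : c ^+ 2 + s ^+ 2 = 1 by exact: cos2Dsin2.
by transitivity (F ^+ 2 * (c ^+ 2 + s ^+ 2)); [ring|rewrite cs mulr1].
Qed.

Lemma oneDsqr_scaled_integrable : L1 (fun w => (1 + (w / 4) ^+ 2 / 4)^-1).
Proof.
have E : (fun w : R => (1 + (w / 4) ^+ 2 / 4)^-1) =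
    (fun x : R => (1 + x ^+ 2)^-1) \o (fun w => w / 8).
  by apply/funext => w /=; congr (_^-1); field.
apply: (integrable_dominated _ _ (integrable_scale 64 oneDsqr_integrable)).
  rewrite E; apply: (measurableT_comp (integrable_measurable oneDsqr_integrable)).
  by measurable_auto.
move=> w; have w2 := sqr_ge0 w.
have u0 : 0 < 1 + (w / 4) ^+ 2 / 4 by have := sqr_ge0 (w / 4); lra.
rewrite ger0_norm ?invr_ge0 ?(ltW u0) // ler_pdivlMr; last by lra.
rewrite mulrC ler_pdivrMr //; lra.
Qed.

Lemma Re_psi_hat_integrable m l : (2 <= m)%N -> (0 < l <= m)%N ->
  in_L2 (@psi_hat R m l) ->
  L1 (fun w => Re (psi_hat m l w)) /\ L1 (fun w => Im (psi_hat m l w)).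
Proof.
move=> m2 lm [m1 m3 _].
split; apply: (integrable_dominated _ _ oneDsqr_scaled_integrable) => // w.
- apply: le_trans (norm_Re_le _) _; rewrite normc_psi_hat; exact: framelet_symbol_le.
- apply: le_trans (norm_Im_le _) _; rewrite normc_psi_hat; exact: framelet_symbol_le.
Qed.

Section gauss.
Variables (m l : nat) (lm : (0 < l <= m)%N).
(** At t = w/4, (2m - l) t^2/3 = a w^2; likewise [k] collects the factor 4^(-l) of t^l. *)
Let a : R := (2 * m%:R - l%:R) / 48.
Let k : R := Num.sqrt 'C(m, l)%:R / 4 ^+ l.

Let ml0 : 0 < 2 * m%:R - l%:R :> R.
Proof.
have /andP[l0 lem] := lm.
have : l%:R <= m%:R :> R by rewrite ler_nat.
have : 0 < m%:R :> R by rewrite ltr0n (leq_trans l0).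
lra.
Qed.

Let a0 : 0 < a. Proof. by rewrite divr_gt0. Qed.

Lemma gauss_symbolE (w : R) :
  gauss_symbol m l (w / 4) = k * (w ^+ l * expR (- (a * w ^+ 2))).
Proof.
rewrite /gauss_symbol /k expr_div_n -!mulrA; congr (_ * _).
by rewrite mulrCA; congr (_ * (_ * expR _)); rewrite /a; field.
Qed.

Lemma gauss_symbol_moment (c x : R) :
  RI (fun w => gauss_symbol m l (w / 4) * cos (w * x + (c + l%:R * (pi / 2)))) =
  k * gauss_moment a l c x.
Proof.
rewrite /gauss_moment -RintegralZl //; last first.
  by apply: integrable_mul_cos; exact: moment_integrable.
by congr (Rintegral _ _ _); apply/funext => w; rewrite gauss_symbolE -mulrA.
Qed.

Lemma gauss_moment0E (x : R) : gauss m l x = k / (2 * pi) * gauss_moment a 0 0 x.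
Proof.
rewrite gauss_moment0 // cos0 mul1r /gauss mulrA.
have pi0 := pi_gt0 R.
have -> : x ^+ 2 / (4 * a) = 12 * x ^+ 2 / (2 * m%:R - l%:R).
  by rewrite /a; field; rewrite gt_eqF.
congr (_ * _); rewrite /gaussC /k.
have m0 : 0 < m%:R - l%:R / 2 :> R by have := ml0; lra.
have -> : Num.sqrt (pi / a) = 2 * pi * (Num.sqrt (6 / pi) / Num.sqrt (m%:R - l%:R / 2)).
  (* Here the normalisation [gaussC] arises: its square root factors are sqrt(pi/a) divided by 2
     pi. *)
  have -> : pi / a = (2 * pi) ^+ 2 * (6 / pi / (m%:R - l%:R / 2)).
    move: (pi : R) pi0 => p p0; rewrite /a; field.
    by rewrite !gt_eqF //; have := ml0; lra.
  rewrite sqrtrM ?sqr_ge0 // sqrtr_sqr ger0_norm; last by lra.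
  rewrite sqrtrM; last by rewrite divr_ge0 // ltW.
  by rewrite [Num.sqrt (_^-1)]sqrtrV ?(ltW m0).
have s0 : Num.sqrt (m%:R - l%:R / 2) != 0 :> R by rewrite gt_eqF // sqrtr_gt0.
have f0 : (4 : R) ^+ l != 0 by rewrite expf_neq0 // pnatr_eq0.
move: (pi : R) pi0 => p p0; field.
by rewrite f0 s0 gt_eqF.
Qed.

Lemma gauss_derivE (x : R) : 2 * pi * gauss_deriv m l x =
  RI (fun w => gauss_symbol m l (w / 4) *
               cos (w * (x - jpar R m / 2) + l%:R * (pi / 2))).
Proof.
have := gauss_symbol_moment 0 (x - jpar R m / 2).
under eq_fun do rewrite add0r; move=> ->.
rewrite /gauss_deriv; have -> : @gauss R m l = (fun x => k / (2 * pi) * gauss_moment a 0 0 x).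
  by apply/funext => z; exact: gauss_moment0E.
rewrite derive1n_gauss_moment //.
by rewrite [k / _]mulrC !mulrA mulfV ?mul1r // mulf_neq0 // gt_eqF // pi_gt0.
Qed.

(** The inverse transform of the Gaussian symbol is real; this zero is what the imaginary part of
    the framelet is compared with. *)
Lemma gauss_symbol_sin (x : R) : 0 =
  RI (fun w => gauss_symbol m l (w / 4) * sin (w * x + l%:R * (pi / 2))).
Proof.
have := gauss_symbol_moment (- (pi / 2)) x; rewrite gauss_moment_odd // mulr0 => <-.
congr (Rintegral _ _ _); apply/funext => w.
by rewrite -cosBpihalf; congr (_ * cos _); ring.
Qed.

Lemma gauss_symbol_integrable : L1 (fun w => gauss_symbol m l (w / 4)).
Proof.
under eq_fun do rewrite gauss_symbolE.
by apply: integrable_scale; exact: moment_integrable.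
Qed.

End gauss.

Lemma symbol_L1_diff_le : exists2 K : R, 0 < K & forall m l, (2 <= m)%N ->
  (0 < l <= m)%N -> L1 (fun w => framelet_symbol m l (w / 4)) ->
  RI (fun w => `|framelet_symbol m l (w / 4) - gauss_symbol m l (w / 4)|) <=
  K / (m%:R * Num.sqrt m%:R).
Proof.
have [K K0 hK] := @symbol_diff_le R.
pose L := RI (fun w => (1 + (w / 4) ^+ 2 / 4)^-1).
have L0 : 0 <= L.
  by apply: Rintegral_ge0 => w _; rewrite invr_ge0; have := sqr_ge0 (w / 4); lra.
have pi0 := pi_gt0 R.
(* 384 = 24 * 4^2, from t = w/4. The Gaussian term then integrates to (K/m) sqrt(c pi/m), the same
   order as the tail. *)
have [c c0 cE] : exists2 c : R, 0 < c & c = 384 by exists 384; [lra|].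
exists (K * (Num.sqrt (c * pi) + L)) => [|m l m2 lm iF].
  by rewrite mulr_gt0 // ltr_wpDr // sqrtr_gt0 mulr_gt0.
have m0 : 0 < m%:R :> R by rewrite ltr0n; lia.
have a0 : 0 < m%:R / c :> R by rewrite divr_gt0.
have ig := gauss_integrable 0 a0.
have iL := oneDsqr_scaled_integrable.
pose dom w := K / m%:R * expR (- (m%:R / c * (w - 0) ^+ 2)) +
  K / (m%:R * Num.sqrt m%:R) * (1 + (w / 4) ^+ 2 / 4)^-1.
have idom : L1 dom by apply: integrable_add; exact: integrable_scale.
apply: (@le_trans _ _ (RI dom)).
  apply: Rintegral_le => //.
    apply: integrable_normfun; apply: integrable_sub => //.
    exact: gauss_symbol_integrable.
  move=> w; apply: le_trans (hK m l (w / 4) m2 lm) _.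
  rewrite /dom subr0 lerD2r.
  suff -> : m%:R * (w / 4) ^+ 2 / 24 = m%:R / c * w ^+ 2 by [].
  by rewrite cE; field.
rewrite RintegralD //; [|exact: integrable_scale|exact: integrable_scale].
rewrite RintegralZl // (@RintegralZl _ _ _ mu setT _ (K / (m%:R * Num.sqrt m%:R))) // -/L.
rewrite Rintegral_gauss //.
have -> : pi / (m%:R / c) = c * pi / m%:R :> R.
  by rewrite invf_div mulrA [pi * c]mulrC.
rewrite sqrtrM; last by rewrite mulr_ge0 ?ltW.
rewrite [Num.sqrt (_^-1)]sqrtrV ?(ltW m0) //; move: (Num.sqrt (c * pi)) => q.
have s0 : Num.sqrt m%:R != 0 :> R by rewrite gt_eqF // sqrtr_gt0.
rewrite le_eqVlt; apply/orP; left; apply/eqP.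
by field; rewrite s0 gt_eqF.
Qed.

End approximation.

(** * Pointwise error of the Gaussian approximation *)

Section framelet_error.
Context {R : realType}.
Notation mu := (@lebesgue_measure R).
Local Notation L1 f := (mu.-integrable setT (EFin \o f)).
Local Notation RI f := (Rintegral mu setT f).

Lemma framelet_gauss_le : exists2 K : R, 0 < K &
  forall m l (psi : R -> R[i]) (x : R), (2 <= m)%N -> (0 < l <= m)%N ->
  bspline_framelet m l psi ->
  Normc.normc (psi x - (gauss_deriv m l x)%:C) <= K / (m%:R * Num.sqrt m%:R).
Proof.
have [K K0 hK] := @symbol_L1_diff_le R.
have pi0 := pi_gt0 R.
(* Real and imaginary parts each contribute the L1 bound divided by 2 pi. *)
exists (K / pi) => [|m l psi x m2 lm [fpsi cpsi]]; first by rewrite divr_gt0.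
have [_ L2hat _] := fpsi.
have [iRe iIm] := Re_psi_hat_integrable m2 lm L2hat.
have [eRe eIm] := complex_fourier_inversion x fpsi cpsi iRe iIm.
set y := x - jpar R m / 2.
pose F (w : R) := framelet_symbol m l (w / 4).
pose H (w : R) := gauss_symbol m l (w / 4).
have eRe' : 2 * pi * complex.Re (psi x) = RI (fun w => F w * cos (w * y + l%:R * (pi / 2))).
  by rewrite eRe; congr (Rintegral _ _ _); apply/funext => w; rewrite Re_psi_hat_rotate.
have eIm' : 2 * pi * complex.Im (psi x) = RI (fun w => F w * sin (w * y + l%:R * (pi / 2))).
  by rewrite eIm; congr (Rintegral _ _ _); apply/funext => w; rewrite Im_psi_hat_rotate.
have iF : L1 F.
  apply: (integrable_dominated _ _ oneDsqr_scaled_integrable); last first.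
    by move=> w; exact: framelet_symbol_le.
  (* Measurability of F is read off from [psi_hat]: y = j/2 cancels the shift, and projecting on the
     angle l pi/2 undoes i^l. *)
  have FE w : F w =
      complex.Re (psi_hat m l w * expi (w * (jpar R m / 2))) * cos (l%:R * (pi / 2)) +
      complex.Im (psi_hat m l w * expi (w * (jpar R m / 2))) * sin (l%:R * (pi / 2)).
    rewrite Re_psi_hat_rotate Im_psi_hat_rotate subrr mulr0 add0r.
    rewrite -(mulrA _ (cos _)) -(mulrA _ (sin _)) -mulrDr.
    by rewrite -!expr2 cos2Dsin2 mulr1.
  have -> : F = (fun w =>
      (complex.Re (psi_hat m l w) * cos (w * (jpar R m / 2)) -
       complex.Im (psi_hat m l w) * sin (w * (jpar R m / 2))) * cos (l%:R * (pi / 2)) +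
      (complex.Re (psi_hat m l w) * sin (w * (jpar R m / 2)) +
       complex.Im (psi_hat m l w) * cos (w * (jpar R m / 2))) * sin (l%:R * (pi / 2))).
    by apply/funext => w; rewrite FE; case: (psi_hat m l w).
  have mRe := integrable_measurable iRe; have mIm := integrable_measurable iIm.
  by measurable_auto.
have iH : L1 H by exact: gauss_symbol_integrable.
have iFH : L1 (fun w => `|F w - H w|).
  by apply: integrable_normfun; exact: integrable_sub.
have mF := integrable_measurable iF; have mH := integrable_measurable iH.
have diff (c : R -> R) : measurable_fun setT c -> (forall w, `|c w| <= 1) ->
    `|RI (fun w => F w * c w) - RI (fun w => H w * c w)| <= K / (m%:R * Num.sqrt m%:R).
  move=> mc c1; rewrite -RintegralB //; [|exact: integrable_mul_le1|exact: integrable_mul_le1].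
  apply: le_trans (hK m l m2 lm iF); apply: Rintegral_norm_le => //; first measurable_auto.
  by move=> w; rewrite -mulrBl normrM ler_piMr.
have mc : measurable_fun setT (fun w : R => cos (w * y + l%:R * (pi / 2))) by measurable_auto.
have ms : measurable_fun setT (fun w : R => sin (w * y + l%:R * (pi / 2))) by measurable_auto.
have := diff _ mc (fun w => norm_cos_le1 _); rewrite -eRe' -gauss_derivE // => dRe.
have := diff _ ms (fun w => norm_sin_le1 _); rewrite -eIm' -gauss_symbol_sin // subr0 => dIm.
apply: le_trans (normc_le_ReIm _) _.
have -> : complex.Re (psi x - (gauss_deriv m l x)%:C) = complex.Re (psi x) - gauss_deriv m l x.
  by case: (psi x).
have -> : complex.Im (psi x - (gauss_deriv m l x)%:C) = complex.Im (psi x).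
  by case: (psi x) => a b /=; rewrite subr0.
rewrite -mulrBr normrM gtr0_norm ?mulr_gt0 // in dRe.
rewrite normrM gtr0_norm ?mulr_gt0 // in dIm.
rewrite mulrAC ler_pdivlMr //.
move: (pi : R) pi0 dRe dIm => p p0.
move: `|_| `|_| (K / _) => u v w; lra.
Qed.

End framelet_error.

Local Close Scope classical_set_scope.

Theorem theorem7 (R : realType) :
  exists C : R, 0 < C /\
    forall (m : nat), (2 <= m)%N ->
    forall (l : nat), (1 <= l <= m)%N ->
    forall (psi : R -> R[i]), bspline_framelet m l psi ->
    forall x : R,
      Normc.normc (psi x - (gauss_deriv m l x)%:C) <=
        C * ((ln m%:R `^ (5 / 2)) / (m%:R `^ (3 / 2))).
Proof.
have [K K0 hK] := @framelet_gauss_le R.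
have ln2 : 0 < ln (2 : R) by apply: ln_gt0; rewrite ltr1n.
have c0 : 0 < ln (2 : R) `^ (5 / 2) by rewrite powR_gt0.
(* For m >= 2, ln m >= ln 2, so dividing by the value at 2 makes the logarithmic factor at least
   1. *)
exists (K / ln (2 : R) `^ (5 / 2)); split=> [|m m2 l lm psi hpsi x].
  by rewrite divr_gt0.
apply: le_trans (hK m l psi x m2 lm hpsi) _.
have m1 : 0 < m%:R :> R by rewrite ltr0n (leq_trans _ m2).
have -> : (m%:R : R) `^ (3 / 2) = m%:R * Num.sqrt m%:R.
  have -> : 3 / 2 = 1 + 2^-1 :> R by field.
  by rewrite powRD ?powRr1 ?powR12_sqrt ?ltW // gt_eqF // implybT.
rewrite mulrA ler_pM2r ?invr_gt0 ?mulr_gt0 ?sqrtr_gt0 //.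
rewrite mulrAC -mulrA ler_peMr ?(ltW K0) // ler_pdivlMr // mul1r.
apply: ge0_ler_powR; rewrite ?nnegrE //.
- exact: ltW.
- by rewrite ln_ge0 // ler1n ltnW.
- by rewrite ler_ln ?posrE // ler_nat.
Qed.
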